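(* Let $p,q$ be positive integers and let $(M,\phi,Z_1,Z_2,\alpha_1,\alpha_2,g)$ be a normal metric contact pair manifold of type $(p,q)$, so $\dim M=2p+2q+2$. Suppose that $M$ is conformally flat, i.e. its conformal curvature tensor $\mathcal{C}$ vanishes identically. Then $(M,g)$ is an Einstein manifold with negative scalar curvature, and $(M,g)$ has positive sectional curvature.
   Context: Contact pairs. Let $M$ be a differentiable manifold of dimension $2p+2q+2$, with $p,q$ positive integers. A pair of $1$-forms $(\alpha_1,\alpha_2)$ on $M$ is a contact pair of type $(p,q)$ if $\alpha_1\wedge(d\alpha_1)^p\wedge\alpha_2\wedge(d\alpha_2)^q\neq 0$ (everywhere), $(d\alpha_1)^{p+1}=0$ and $(d\alpha_2)^{q+1}=0$. Its Reeb vector fields $Z_1,Z_2$ are the commuting vector fields uniquely determined by $\alpha_1(Z_1)=\alpha_2(Z_2)=1$, $\alpha_1(Z_2)=\alpha_2(Z_1)=0$, and $i_{Z_i}d\alpha_j=0$ for $i,j\in\{1,2\}$, where $i_X$ denotes contraction with $X$. The characteristic foliations $\mathcal{F}_1,\mathcal{F}_2$ have tangent bundles $T\mathcal{F}_i=\ker\alpha_i\cap\ker d\alpha_i$. Almost contact pair structure. This is a triple $(\alpha_1,\alpha_2,\phi)$ where $(\alpha_1,\alpha_2)$ is a contact pair and $\phi$ is a $(1,1)$-tensor field with $\phi^2=-I+\alpha_1\otimes Z_1+\alpha_2\otimes Z_2$ and $\phi Z_1=\phi Z_2=0$. Standing assumption: $\phi$ is decomposable, i.e. $T\mathcal{F}_1$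 and $T\mathcal{F}_2$ are invariant under $\phi$. Metric contact pair manifold. A Riemannian metric $g$ is associated if $g(X_1,\phi X_2)=(d\alpha_1+d\alpha_2)(X_1,X_2)$ and $g(X_1,Z_i)=\alpha_i(X_1)$ for $i=1,2$ and all vector fields $X_1,X_2$. With such an associated metric, $(M,\phi,Z_1,Z_2,\alpha_1,\alpha_2,g)$ is called a metric contact pair manifold. The exterior derivative is normalized by $d\alpha(X,Y)=\frac12\left(X\alpha(Y)-Y\alpha(X)-\alpha([X,Y])\right)$; on a normal metric contact pair manifold this corresponds to $\nabla_X(Z_1+Z_2)=-\phi X$. Normality. A metric contact pair manifold is normal if the two almost complex structures $J=\phi-\alpha_2\otimes Z_1+\alpha_1\otimes Z_2$ and $T=\phi+\alpha_2\otimes Z_1-\alpha_1\otimes Z_2$ are both integrable. Curvature conventions. $\nabla$ is the Levi-Civita connection, $R(X_1,X_2)X_3=\nabla_{X_1}\nabla_{X_2}X_3-\nabla_{X_2}\nabla_{X_1}X_3-\nabla_{[X_1,X_2]}X_3$, $QX=\sum_i R(X,E_i)E_i$ for a local orthonormal frame $(E_i)$, $Ric(X_1,X_2)=g(QX_1,X_2)$, and $scal=\sum_i Ric(E_i,E_i)$. Einstein means $Ric=\lambda g$ with $\lambda$ constant. Conformal curvature tensor. In dimension $2p+2q+2$ it is $$\mathcal{C}(X_1,X_2)X_3=R(X_1,X_2)X_3+\frac{scal}{(2p+2q+1)(2p+2q)}\left(g(X_2,X_3)X_1-g(X_1,X_3)X_2\right)+\frac{1}{2p+2q}\left(g(X_1,X_3)QX_2-g(X_2,X_3)QX_1+Ric(X_1,X_3)X_2-Ric(X_2,X_3)X_1\right).$$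 *)

(* Defs.v *)
From mathcomp Require Import all_boot all_order all_algebra.
From mathcomp Require Import all_fingroup.
From mathcomp Require Import all_classical all_reals all_analysis.

Set Implicit Arguments.
Unset Strict Implicit.
Unset Printing Implicit Defensive.

Import Order.TTheory GRing.Theory Num.Theory.
Import numFieldNormedType.Exports.

Local Open Scope classical_set_scope.
Local Open Scope ring_scope.

(* Conventions. In a chart of an n-manifold, a tangent vector is a row vector
   u : 'rV_n, a covector is a column vector a : 'cV_n with value u *m a on u,
   an endomorphism is a matrix f : 'M_n acting by u |-> u *m f (so that
   composition is "first factor first"), and a bilinear form is a matrix
   G : 'M_n with value u *m G *m v^T on (u, v). In particular the endomorphism
   a (x) z : u |-> a(u) z is the matrix a *m z. *)

Section Smooth.
Variables (R : realType) (n : nat) (V : normedModType R).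

Fixpoint diff_class (k : nat) (U : set 'rV[R]_n) (f : 'rV[R]_n -> V) : Prop :=
  match k with
  | 0 => forall y, U y -> {for y, continuous f}
  | k'.+1 => (forall y, U y -> differentiable f y) /\
             forall v : 'rV[R]_n, diff_class k' U (fun y => 'D_v f y)
  end.

Definition smooth_on (U : set 'rV[R]_n) (f : 'rV[R]_n -> V) : Prop :=
  forall k, diff_class k U f.

End Smooth.

Record manifold (R : realType) (n : nat) := Manifold {
  mpoint :> topologicalType;
  mpoint_hausdorff : hausdorff_space mpoint;
  mpoint_second_countable : second_countable (T := mpoint);
  chart_index : Type;
  chart_dom : chart_index -> set mpoint;
  chart : chart_index -> mpoint -> 'rV[R]_n;
  cochart : chart_index -> 'rV[R]_n -> mpoint;
  chart_dom_open : forall c, open (chart_dom c);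
  chart_image_open : forall c, open (chart c @` chart_dom c);
  chart_continuous : forall c, {within chart_dom c, continuous (chart c)};
  cochart_continuous :
    forall c, {within chart c @` chart_dom c, continuous (cochart c)};
  chartK : forall c x, chart_dom c x -> cochart c (chart c x) = x;
  chart_cover : forall x, exists c, chart_dom c x;
  chart_compat : forall c c',
    smooth_on (chart c @` (chart_dom c `&` chart_dom c'))
              (fun y => chart c' (cochart c y))
}.

Section Fields.
Variables (R : realType) (n : nat) (M : manifold R n).

Definition chart_img (c : chart_index M) : set 'rV[R]_n :=
  chart c @` chart_dom c.

(* The coordinate change from c to c' at x, applied to a tangent vector. *)
Definition jac (c c' : chart_index M) (x : M) (u : 'rV[R]_n) : 'rV[R]_n :=
  'D_u (fun y => chart c' (cochart c y)) (chart c x).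

(* Global smooth tensor fields, given by their components in every chart of
   the atlas, subject to the usual transformation laws. *)

Record vector_field := VectorField {
  vf_val :> chart_index M -> 'rV[R]_n -> 'rV[R]_n;
  vf_smooth : forall c, smooth_on (chart_img c) (vf_val c);
  vf_compat : forall c c' x, chart_dom c x -> chart_dom c' x ->
    vf_val c' (chart c' x) = jac c c' x (vf_val c (chart c x))
}.

Record one_form := OneForm {
  of_val :> chart_index M -> 'rV[R]_n -> 'cV[R]_n;
  of_smooth : forall c, smooth_on (chart_img c) (of_val c);
  of_compat : forall c c' x, chart_dom c x -> chart_dom c' x -> forall u,
    u *m of_val c (chart c x) = jac c c' x u *m of_val c' (chart c' x)
}.

Record endo_field := EndoField {
  ef_val :> chart_index M -> 'rV[R]_n -> 'M[R]_n;
  ef_smooth : forall c, smooth_on (chart_img c) (ef_val c);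
  ef_compat : forall c c' x, chart_dom c x -> chart_dom c' x -> forall u,
    jac c c' x (u *m ef_val c (chart c x)) =
    jac c c' x u *m ef_val c' (chart c' x)
}.

Record riemannian_metric := RiemannianMetric {
  rm_val :> chart_index M -> 'rV[R]_n -> 'M[R]_n;
  rm_smooth : forall c, smooth_on (chart_img c) (rm_val c);
  rm_compat : forall c c' x, chart_dom c x -> chart_dom c' x -> forall u v,
    u *m rm_val c (chart c x) *m v^T =
    jac c c' x u *m rm_val c' (chart c' x) *m (jac c c' x v)^T;
  rm_sym : forall c y, chart_img c y -> (rm_val c y)^T = rm_val c y;
  rm_pos : forall c y, chart_img c y -> forall u : 'rV[R]_n, u != 0 ->
    0 < (u *m rm_val c y *m u^T) 0 0
}.

End Fields.

Section ExteriorAlgebra.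
Variables (R : realType) (n : nat).

(* A k-form at a point; its k arguments are the rows of a matrix. *)
Definition kform (k : nat) := 'M[R]_(k, n) -> R.

Definition kform1 (a : 'cV[R]_n) : kform 1 := fun A => (A *m a) 0 0.

Definition kform2 (b : 'rV[R]_n -> 'rV[R]_n -> R) : kform 2 :=
  fun A => b (row ord0 A) (row ord_max A).

(* Normalised by 1 / (k + l)!, the convention matching the factor 1/2 in the
   exterior derivative below. *)
Definition wedge (k l : nat) (w : kform k) (h : kform l) : kform (k + l) :=
  fun A => (k + l)`!%:R^-1 *
    \sum_(s : 'S_(k + l)) (-1) ^+ s *
      (w (usubmx (row_perm s A)) * h (dsubmx (row_perm s A))).

Fixpoint wedge_pow (w : kform 2) (m : nat) : kform (m * 2) :=
  match m return kform (m * 2) with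
  | 0 => fun=> 1
  | m'.+1 => wedge w (@wedge_pow w m')
  end.

End ExteriorAlgebra.

Arguments wedge_pow {R n} w m A.

(* Calculus on an open subset of R^n, where fields are functions of the
   coordinates. *)
Section LocalCalculus.
Variables (R : realType) (n : nat).
Local Notation vec := 'rV[R]_n.
Local Notation vfield := ('rV[R]_n -> 'rV[R]_n).

Definition pairing (u : vec) (a : 'cV[R]_n) : R := (u *m a) 0 0.

Definition lie (X Y : vfield) : vfield :=
  fun y => 'D_(X y) Y y - 'D_(Y y) X y.

Definition dext (a : vec -> 'cV[R]_n) (X Y : vfield) (y : vec) : R :=
  2^-1 * ('D_(X y) (fun z => pairing (Y z) (a z)) y
          - 'D_(Y y) (fun z => pairing (X z) (a z)) y
          - pairing (lie X Y y) (a y)).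

(* dext is tensorial, so its value on tangent vectors at y may be computed on
   their constant extensions; likewise for the curvature below. *)
Definition dext_at (a : vec -> 'cV[R]_n) (y u v : vec) : R :=
  dext a (cst u) (cst v) y.

Definition nijenhuis (J : vec -> 'M[R]_n) (X Y : vfield) : vfield :=
  let JX := fun y => X y *m J y in
  let JY := fun y => Y y *m J y in
  fun y => lie X Y y *m J y *m J y + lie JX JY y
           - lie JX Y y *m J y - lie X JY y *m J y.

Definition integrable_on (U : set vec) (J : vec -> 'M[R]_n) : Prop :=
  forall X Y : vfield, smooth_on U X -> smooth_on U Y ->
  forall y, U y -> nijenhuis J X Y y = 0.

Section Metric.
Variable G : vec -> 'M[R]_n.

Definition inner (y u v : vec) : R := (u *m G y *m v^T) 0 0.

(* Christoffel symbols of the first kind: g(Gamma(u, v), w) for constant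
   fields u, v, w, by the Koszul formula. *)
Definition christoffel1 (y u v w : vec) : R :=
  2^-1 * ('D_u (fun z => inner z v w) y + 'D_v (fun z => inner z u w) y
          - 'D_w (fun z => inner z u v) y).

Definition christoffel (y u v : vec) : vec :=
  (\row_k christoffel1 y u v (delta_mx 0 k)) *m invmx (G y).

(* The Levi-Civita connection. *)
Definition nabla (X Y : vfield) : vfield :=
  fun y => 'D_(X y) Y y + christoffel y (X y) (Y y).

Definition curvature (X Y Z : vfield) : vfield :=
  fun y => nabla X (nabla Y Z) y - nabla Y (nabla X Z) y
           - nabla (lie X Y) Z y.

Definition curv (y u v w : vec) : vec := curvature (cst u) (cst v) (cst w) y.

(* Some orthonormal basis at y, given by the rows of a matrix; the quantities
   Q and scal below do not depend on the choice. *)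
Definition frame (y : vec) : 'M[R]_n :=
  xget 0 [set E : 'M[R]_n | E *m G y *m E^T = 1%:M].

Definition ricci_op (y u : vec) : vec :=
  \sum_(i < n) curv y u (row i (frame y)) (row i (frame y)).

Definition ricci (y u v : vec) : R := inner y (ricci_op y u) v.

Definition scal (y : vec) : R :=
  \sum_(i < n) ricci y (row i (frame y)) (row i (frame y)).

Definition sectional (y u v : vec) : R :=
  inner y (curv y u v v) u
  / (inner y u u * inner y v v - inner y u v ^+ 2).

(* For n = 2p + 2q + 2, n.-1 = 2p + 2q + 1 and n.-2 = 2p + 2q. *)
Definition conformal_curv (y u v w : vec) : vec :=
  curv y u v w
  + (scal y / (n.-1 * n.-2)%:R) *: (inner y v w *: u - inner y u w *: v)
  + (n.-2)%:R^-1 *: (inner y u w *: ricci_op y v - inner y v w *: ricci_op y u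
                     + ricci y u w *: v - ricci y v w *: u).

End Metric.
End LocalCalculus.

Section Geometry.
Variables (R : realType) (n : nat) (M : manifold R n).

Definition conformally_flat (g : riemannian_metric M) : Prop :=
  forall c y, chart_img c y -> forall u v w, conformal_curv (g c) y u v w = 0.

Definition einstein (g : riemannian_metric M) : Prop :=
  exists lambda : R, forall c y, chart_img c y -> forall u v,
    ricci (g c) y u v = lambda * inner (g c) y u v.

Definition negative_scalar_curvature (g : riemannian_metric M) : Prop :=
  forall c y, chart_img c y -> scal (g c) y < 0.

Definition positive_sectional_curvature (g : riemannian_metric M) : Prop :=
  forall c y, chart_img c y -> forall u v : 'rV[R]_n,
    row_free (col_mx u v) -> 0 < sectional (g c) y u v.

Definition contact_pair (p q : nat) (a1 a2 : one_form M) : Prop :=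
  forall c y, chart_img c y ->
  let da1 := kform2 (dext_at (a1 c) y) in
  let da2 := kform2 (dext_at (a2 c) y) in
  [/\ exists A, wedge (wedge (wedge (kform1 (a1 c y)) (wedge_pow da1 p))
                             (kform1 (a2 c y)))
                      (wedge_pow da2 q) A != 0,
      forall A, wedge_pow da1 p.+1 A = 0 &
      forall A, wedge_pow da2 q.+1 A = 0].

Definition reeb_pair (a1 a2 : one_form M) (Z1 Z2 : vector_field M) : Prop :=
  forall c y, chart_img c y ->
  [/\ pairing (Z1 c y) (a1 c y) = 1 /\ pairing (Z2 c y) (a2 c y) = 1,
      pairing (Z2 c y) (a1 c y) = 0 /\ pairing (Z1 c y) (a2 c y) = 0,
      forall v, dext_at (a1 c) y (Z1 c y) v = 0 /\
                dext_at (a2 c) y (Z1 c y) v = 0,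
      forall v, dext_at (a1 c) y (Z2 c y) v = 0 /\
                dext_at (a2 c) y (Z2 c y) v = 0 &
      lie (Z1 c) (Z2 c) y = 0].

(* The fibre at y of the characteristic distribution ker a /\ ker da. *)
Definition char_dist (a : one_form M) (c : chart_index M) (y : 'rV[R]_n) :
    set 'rV[R]_n :=
  [set u | pairing u (a c y) = 0 /\ forall v, dext_at (a c) y u v = 0].

Definition decomposable (a1 a2 : one_form M) (phi : endo_field M) : Prop :=
  forall c y, chart_img c y -> forall u,
    (char_dist a1 c y u -> char_dist a1 c y (u *m phi c y)) /\
    (char_dist a2 c y u -> char_dist a2 c y (u *m phi c y)).

Definition almost_contact_pair (p q : nat) (phi : endo_field M)
    (Z1 Z2 : vector_field M) (a1 a2 : one_form M) : Prop :=
  [/\ contact_pair p q a1 a2,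
      reeb_pair a1 a2 Z1 Z2,
      forall c y, chart_img c y ->
        [/\ phi c y *m phi c y =
              - 1%:M + a1 c y *m Z1 c y + a2 c y *m Z2 c y,
            Z1 c y *m phi c y = 0 & Z2 c y *m phi c y = 0] &
      decomposable a1 a2 phi].

Definition associated_metric (phi : endo_field M) (Z1 Z2 : vector_field M)
    (a1 a2 : one_form M) (g : riemannian_metric M) : Prop :=
  forall c y, chart_img c y ->
    (forall u v, inner (g c) y u (v *m phi c y) =
                 dext_at (a1 c) y u v + dext_at (a2 c) y u v) /\
    (forall u, inner (g c) y u (Z1 c y) = pairing u (a1 c y) /\
               inner (g c) y u (Z2 c y) = pairing u (a2 c y)).

Definition metric_contact_pair (p q : nat) (phi : endo_field M)
    (Z1 Z2 : vector_field M) (a1 a2 : one_form M)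
    (g : riemannian_metric M) : Prop :=
  almost_contact_pair p q phi Z1 Z2 a1 a2 /\
  associated_metric phi Z1 Z2 a1 a2 g.

(* Integrability of an almost complex structure is the vanishing of its
   Nijenhuis torsion. *)
Definition normal_pair (phi : endo_field M) (Z1 Z2 : vector_field M)
    (a1 a2 : one_form M) : Prop :=
  forall c,
    integrable_on (chart_img c)
      (fun y => phi c y - a2 c y *m Z1 c y + a1 c y *m Z2 c y) /\
    integrable_on (chart_img c)
      (fun y => phi c y + a2 c y *m Z1 c y - a1 c y *m Z2 c y).

Definition normal_metric_contact_pair (p q : nat) (phi : endo_field M)
    (Z1 Z2 : vector_field M) (a1 a2 : one_form M)
    (g : riemannian_metric M) : Prop :=
  metric_contact_pair p q phi Z1 Z2 a1 a2 g /\ normal_pair phi Z1 Z2 a1 a2.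

End Geometry.

(* Main.v *)
Require Import Defs.
From HB Require Import structures.
From mathcomp Require Import all_boot all_order all_algebra.
From mathcomp Require Import all_fingroup.
From mathcomp Require Import all_classical all_reals all_analysis.
From mathcomp Require Import ring lra zify.

Set Implicit Arguments.
Unset Strict Implicit.
Unset Printing Implicit Defensive.

Import Order.TTheory GRing.Theory Num.Theory.
Import numFieldNormedType.Exports.

Local Open Scope classical_set_scope.
Local Open Scope ring_scope.

(** The hypotheses force the manifold to be empty, so that the three conclusions
    hold over an empty set of points. Indeed no point of a normal metric contact
    pair manifold has a vanishing conformal curvature tensor, for the following
    reason.

    Vanishing of this tensor implies that, for an orthonormal pair [(x, z)], the
    sectional curvature [K(x, z)] is a sum [h x + h z] for some function [h]
    ([conformal_flat_pairing]); in particular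
    [K(x1, z1) + K(x2, z2) = K(x1, z2) + K(x2, z1)] whenever each [x_i] is
    orthogonal to each [z_j]. This is contradicted by [z_j = Z_j], the Reeb
    fields, and [x1], [x2] horizontal vectors with [i_{x1} da2 = 0] and
    [i_{x2} da1 = 0], for which the four values are 1, 1, 0 and 0.

    To compute them, one first shows that each [Z_j] is a Killing field
    ([Reeb_killing]). Both almost complex structures map Reeb fields to Reeb
    fields up to sign, so the vanishing of their torsions relates the Lie
    derivatives of [phi] along [Z1] and [Z2], and together these relations make
    them vanish ([lie_endo_phi]). Cartan's formula gives [L_{Z_j} a_i = 0] and
    [L_{Z_j} da_i = 0] ([lie_col_Reeb], [lie_form_Reeb]), and [g] is determined by
    [phi], [a_i] and [da_i] ([lie_form_G]).

    Since [Z_j] is Killing with dual form [a_j], [g(nabla_x Z_j, .) = da_j(x, .)]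
    ([nabla_mx_dform]) and [g(R(x, Z_j) Z_j, x) = |nabla_x Z_j|^2]
    ([curv_killing]). This is 0 when [i_x da_j = 0]. When instead the other form
    satisfies [i_x da_k = 0] and [x] is horizontal, [da_j(x, .) = g(x, phi .)], so
    that [nabla_x Z_j = - phi x] has the length of [x].

    The vectors [x1] and [x2] exist by linear algebra: a 2-form with vanishing
    power [q + 1] has no symplectic family of [2q + 2] vectors, as the power would
    be positive on it ([wedge_pow_gt0]); hence its restriction to a subspace of
    dimension at least [2q + 2] is degenerate ([wedge_pow_radical]).

    The computations are done in a chart, with the derivatives of vector fields
    and the Christoffel symbols packed in matrices acting on row vectors; the
    calculus needed is the Leibniz rule for matrix products and the symmetry of
    second derivatives ([derive_comm]). *)

(** * Symmetry of second derivatives *)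

Section DirectionalCalculus.
Variables (R : realType) (V : normedModType R).

Lemma is_derive_line (f : V -> R) (p u : V) (s df : R) :
  is_derive (s *: u + p) u f df -> is_derive s 1 (fun r : R => f (r *: u + p)) df.
Proof.
move=> [fd fE].
have E : (fun h : R => h^-1 *: (f ((h *: (1 : R) + s) *: u + p) - f (s *: u + p)))
       = (fun h : R => h^-1 *: (f (h *: u + (s *: u + p)) - f (s *: u + p))).
  by apply/funext => h; rewrite [h *: 1]mulr1 scalerDl addrA.
by split; [rewrite /derivable /= E | rewrite /derive /= E].
Qed.

(** The mean value theorem for [s |-> f(y + s u + t v) - f(y + s u)] on [0, t]
    produces a difference of values of [k = D_u f], which is estimated by the
    differentiability of [k] at [y]. *)
Lemma second_difference (f k : V -> R) (y u v : V) (e : R) : 0 < e ->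
  (\forall z \near y, is_derive z u f (k z)) -> differentiable k y ->
  \forall t \near (0 : R), 0 < t ->
    `|f (t *: u + t *: v + y) - f (t *: u + y) - f (t *: v + y) + f y
      - t ^+ 2 * 'D_v k y| <= e * t ^+ 2.
Proof.
move=> e0 fd kd.
set C := 2 * `|u| + `|v| + 1.
have C0 : 0 < C by rewrite /C ltr_pwDr// addr_ge0 ?mulr_ge0.
have /eqaddoP/(_ (e / C)) := diff_locally kd.
rewrite divr_gt0// => /(_ isT)/nbhs_norm0P[r /= r0 kr].
have /nbhs_normP[r' /= r'0 fr'] := fd.
exists (Num.min r r' / C) => /=; first by rewrite divr_gt0// lt_min r0.
move=> t /=; rewrite sub0r normrN => td t0; move: td; rewrite gtr0_norm// => td.
have tC : t * C < Num.min r r' by rewrite -ltr_pdivlMr.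
have small (a b : R) : 0 <= a <= t -> 0 <= b <= t -> `|a *: u + b *: v| < Num.min r r'.
  move=> /andP[a0 at_] /andP[b0 bt]; apply: le_lt_trans tC.
  rewrite (le_trans (ler_normD _ _))// !normrZ !ger0_norm// /C.
  have := ler_wpM2r (normr_ge0 u) at_; have := ler_wpM2r (normr_ge0 v) bt.
  have := mulr_ge0 (ltW t0) (normr_ge0 u); nra.
have diff_near h : `|h| < Num.min r r' -> is_derive (h + y) u f (k (h + y)).
  by rewrite lt_min => /andP[_ hr]; apply: fr' => /=; rewrite opprD addrC subrK normrN.
have k_near h : `|h| < Num.min r r' ->
    `|k (h + y) - k y - 'd k y h| <= e / C * `|h|.
  by rewrite lt_min => /andP[hr _]; have := kr _ hr; rewrite opprD addrA.
pose F (s : R) := f (s *: u + (t *: v + y)) - f (s *: u + y).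
pose dF (s : R) := k (s *: u + (t *: v + y)) - k (s *: u + y).
have FdF s : 0 <= s <= t -> is_derive s 1 F (dF s).
  move=> st; apply: is_deriveB; apply: is_derive_line.
    by rewrite addrA; apply: diff_near; apply: small; rewrite ?st ?lexx ?(ltW t0).
  apply: diff_near; rewrite -[s *: u]addr0 -(scale0r v).
  by apply: small; rewrite ?st ?lexx ?(ltW t0).
have [| |c] := @MVT R F dF 0 t t0.
- by move=> s; rewrite in_itv /= => /andP[s0 st]; apply: FdF; rewrite (ltW s0) (ltW st).
- apply: derivable_within_continuous => s; rewrite in_itv /= => st.
  by have [] := FdF s st.
rewrite in_itv /= subr0 => /andP[/ltW c0 /ltW ct].
rewrite /F !scale0r !add0r addrA => Fc.
rewrite (_ : _ - _ + f y = dF c * t); last by rewrite -Fc; ring.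
have cI : 0 <= c <= t by rewrite c0.
have [tI zI] : 0 <= t <= t /\ 0 <= (0 : R) <= t by rewrite !lexx (ltW t0).
have k1 := k_near _ (small _ _ cI tI).
have /k_near := small _ _ cI zI; rewrite scale0r addr0 => k2.
have -> : dF c * t - t ^+ 2 * 'D_v k y =
   t * ((k (c *: u + t *: v + y) - k y - 'd k y (c *: u + t *: v))
        - (k (c *: u + y) - k y - 'd k y (c *: u))).
  have dE : 'd k y (t *: v) = t * 'd k y v by rewrite linearZ.
  by rewrite /dF deriveE// linearD /= dE addrA; ring.
rewrite normrM (gtr0_norm t0) expr2 mulrCA ler_pM2l// (le_trans (ler_normB _ _))//.
rewrite (le_trans (lerD k1 k2))// -mulrDr -mulrA ler_pM2l// ler_pdivrMl//.
have := ler_normD (c *: u) (t *: v); rewrite !normrZ !ger0_norm ?(ltW t0)// => N.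
have := ler_wpM2r (normr_ge0 u) ct; have := mulr_ge0 (ltW t0) (normr_ge0 u).
rewrite /C; nra.
Qed.

(** Both iterated derivatives are limits of the same second difference, which is
    symmetric in [u] and [v]. *)
Lemma derive_comm (f k l : V -> R) (y u v : V) :
  (\forall z \near y, is_derive z u f (k z)) ->
  (\forall z \near y, is_derive z v f (l z)) ->
  differentiable k y -> differentiable l y -> 'D_v k y = 'D_u l y.
Proof.
move=> fu fv ud vd; apply/eqP; rewrite -subr_eq0 -normr_le0 -[leRHS]add0r.
apply/ler_addgt0Pr => e e0; rewrite add0r.
have e20 : 0 < e / 2 by rewrite divr_gt0.
have /nbhs_norm0P[r /= r0 ur] := second_difference v e20 fu ud.
have /nbhs_norm0P[s /= s0 us] := second_difference u e20 fv vd.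
pose t := Num.min r s / 2.
have m0 : 0 < Num.min r s by rewrite lt_min r0.
have t0 : 0 < t by rewrite divr_gt0.
have tm : `|t| < Num.min r s by rewrite gtr0_norm// ltr_pdivrMr// ltr_pMr// ltr1n.
clearbody t; move: (tm); rewrite lt_min => /andP[tr ts].
have := ur _ tr t0; have := us _ ts t0.
rewrite [t *: v + t *: u]addrC.
set A := 'D_v _ y; set B := 'D_u _ y => H1 H2; clearbody A B.
have t2 : 0 < t ^+ 2 by rewrite exprn_gt0.
rewrite -(ler_pM2l t2) -[X in X * `|_|](gtr0_norm t2) -normrM.
have -> : t ^+ 2 * (A - B) =
  (f (t *: u + t *: v + y) - f (t *: v + y) - f (t *: u + y) + f y - t ^+ 2 * B) -
  (f (t *: u + t *: v + y) - f (t *: u + y) - f (t *: v + y) + f y - t ^+ 2 * A).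
  by ring.
rewrite (le_trans (ler_normB _ _))// (le_trans (lerD H1 H2))//.
by rewrite -mulrDl -splitr add0r mulrC.
Qed.

End DirectionalCalculus.

(** * Matrix-valued calculus *)

Section MatrixCalculus.
Variables (R : realType) (V : normedModType R).
Implicit Types (y u v : V).

Lemma is_derive_mxP m n (f : V -> 'M[R]_(m, n)) y v (df : 'M[R]_(m, n)) :
  is_derive y v f df <->
  (forall i j, is_derive y v (fun z => f z i j) (df i j)).
Proof.
split=> [[fd <-] i j|fd].
  split; first by have /derivable_mxP := fd; apply.
  by rewrite derive_mx// mxE.
have D : derivable f y v by apply/derivable_mxP => i j; have [] := fd i j.
split=> //; rewrite derive_mx//; apply/matrixP => i j; rewrite mxE.
by have [_ ->] := fd i j.
Qed.

Lemma is_derive_bigsum n (f : 'I_n -> V -> R) y v (df : 'I_n -> R) :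
  (forall i, is_derive y v (f i) (df i)) ->
  is_derive y v (fun z => \sum_(i < n) f i z) (\sum_(i < n) df i).
Proof.
move=> fd; have -> : (fun z => \sum_(i < n) f i z) = \sum_(i < n) f i.
  by apply/funext => z; rewrite fct_sumE.
exact: is_derive_sum.
Qed.

Lemma is_derive_mulmx m n k (f : V -> 'M[R]_(m, n)) (g : V -> 'M[R]_(n, k)) y v
    df dg : is_derive y v f df -> is_derive y v g dg ->
  is_derive y v (fun z => f z *m g z) (df *m g y + f y *m dg).
Proof.
move=> /is_derive_mxP fd /is_derive_mxP gd; apply/is_derive_mxP => i j.
rewrite !mxE -big_split /=.
under [X in is_derive _ _ X]eq_fun do rewrite mxE.
apply: is_derive_bigsum => l.
apply: is_derive_eq (is_deriveM (fd i l) (gd l j)) _.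
by rewrite addrC [g y l j *: _]mulrC.
Qed.

Lemma is_derive_trmx m n (f : V -> 'M[R]_(m, n)) y v df :
  is_derive y v f df -> is_derive y v (fun z => (f z)^T) df^T.
Proof.
move=> /is_derive_mxP fd; apply/is_derive_mxP => i j; rewrite mxE.
by under [X in is_derive _ _ X]eq_fun do rewrite mxE.
Qed.

Lemma derivable_mul (f g : V -> R) y v :
  derivable f y v -> derivable g y v -> derivable (fun z => f z * g z) y v.
Proof. exact: derivableM. Qed.

Lemma derivable_bigprod (I : Type) (r : seq I) (f : I -> V -> R) y v :
  (forall i, derivable (f i) y v) -> derivable (fun z => \prod_(i <- r) f i z) y v.
Proof.
move=> fd; elim: r => [|a r IH].
  by under [X in derivable X]eq_fun do rewrite big_nil; exact: derivable_cst.
under [X in derivable X]eq_fun do rewrite big_cons.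
exact: (derivable_mul (fd a) IH).
Qed.

Lemma derivable_det n (f : V -> 'M[R]_n) y v :
  derivable f y v -> derivable (fun z => \det (f z)) y v.
Proof.
move=> /derivable_mxP fd; rewrite /determinant.
elim: (index_enum _) => [|s r IH].
  by under [X in derivable X]eq_fun do rewrite big_nil; exact: derivable_cst.
under [X in derivable X]eq_fun do rewrite big_cons.
apply: (derivableD _ IH); apply: derivable_mul; first exact: derivable_cst.
by apply: derivable_bigprod => i; exact: fd.
Qed.

(** By Cramer's formula, the entries of the inverse are rational functions of
    those of [f]. *)
Lemma derivable_invmx n (f : V -> 'M[R]_n) y v :
  (\forall z \near y, f z \in unitmx) ->
  derivable f y v -> derivable (fun z => invmx (f z)) y v.
Proof.
move=> funit fd.
have E : {near y, (fun z => (\det (f z))^-1 *: \adj (f z)) =1 fun z => invmx (f z)}.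
  by near=> z; rewrite /invmx (near funit z).
apply: (near_eq_derivable E); apply/derivable_mxP => i j.
under [X in derivable X]eq_fun do rewrite !mxE.
have detn0 : \det (f y) != 0.
  by rewrite -unitfE -unitmxE; exact: nbhs_singleton funit.
apply: derivable_mul; first exact: derivableV (derivable_det fd).
rewrite /cofactor; apply: derivable_mul; first exact: derivable_cst.
apply: derivable_det.
apply/derivable_mxP => k l; under [X in derivable X]eq_fun do rewrite !mxE.
by have /derivable_mxP := fd; apply.
Unshelve. all: by end_near. Qed.

End MatrixCalculus.

(** * Fields on an open set of coordinates *)

(** The Jacobian matrix: [u *m Dmx f y] is ['D_u f y]. *)
HB.lock Definition Dmx (R : realType) n m (f : 'rV[R]_n -> 'rV[R]_m)
    (y : 'rV[R]_n) : 'M[R]_(n, m) :=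
  \matrix_(i < n) 'D_(delta_mx 0 i) f y.

Section OpenSet.
Variables (R : realType) (n : nat) (U : set 'rV[R]_n).
Hypothesis Uopen : open U.
Implicit Types (y u v w : 'rV[R]_n).

Lemma near_open y : U y -> \forall z \near y, U z.
Proof. by move=> Uy; apply: open_nbhs_nbhs. Qed.

Lemma derive_eq_on (W : normedModType R) (f g : 'rV[R]_n -> W) y v :
  U y -> (forall z, U z -> f z = g z) -> 'D_v f y = 'D_v g y.
Proof.
by move=> Uy fg; apply: near_eq_derive; near=> z; apply: fg; near: z;
  exact: near_open.
Unshelve. all: by end_near. Qed.

Lemma derivable_eq_on (W : normedModType R) (f g : 'rV[R]_n -> W) y v :
  U y -> (forall z, U z -> f z = g z) -> derivable f y v -> derivable g y v.
Proof.
by move=> Uy fg; apply: near_eq_derivable; near=> z; apply: fg; near: z;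
  exact: near_open.
Unshelve. all: by end_near. Qed.

Lemma derive_zero_on (W : normedModType R) (f : 'rV[R]_n -> W) y v :
  U y -> (forall z, U z -> f z = 0) -> 'D_v f y = 0.
Proof. by move=> Uy f0; rewrite (derive_eq_on v Uy f0) derive_cst. Qed.

Section Smooth.
Variables (W : normedModType R) (f : 'rV[R]_n -> W).
Hypothesis f_smooth : smooth_on U f.

Lemma smooth_differentiable y : U y -> differentiable f y.
Proof. exact: (f_smooth 1).1. Qed.

Lemma smooth_derivable y v : U y -> derivable f y v.
Proof. by move=> Uy; apply: diff_derivable; apply: smooth_differentiable. Qed.

Lemma smooth_is_derive y v : U y -> is_derive y v f ('D_v f y).
Proof. by move=> Uy; apply: derivableP; apply: smooth_derivable. Qed.

Lemma smooth_derive v : smooth_on U (fun y => 'D_v f y).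
Proof. by move=> k; apply: (f_smooth k.+1).2. Qed.

Lemma smooth_deriveD y u v : U y -> 'D_(u + v) f y = 'D_u f y + 'D_v f y.
Proof. by move=> /smooth_differentiable fy; rewrite !deriveE// linearD. Qed.

Lemma smooth_deriveZ y (a : R) u : U y -> 'D_(a *: u) f y = a *: 'D_u f y.
Proof. by move=> /smooth_differentiable fy; rewrite !deriveE// linearZ. Qed.

End Smooth.

Lemma smooth_derive_comm m k (f : 'rV[R]_n -> 'M[R]_(m, k)) y u v :
  smooth_on U f -> U y ->
  'D_v (fun z => 'D_u f z) y = 'D_u (fun z => 'D_v f z) y.
Proof.
move=> fs Uy.
have fd a := smooth_differentiable (smooth_derive fs a) Uy.
rewrite (derive_mx (@diff_derivable _ _ _ _ _ v (fd u))).
rewrite (derive_mx (@diff_derivable _ _ _ _ _ u (fd v))).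
apply/matrixP => i j; rewrite [LHS]mxE [RHS]mxE.
apply: (@derive_comm _ _ (fun z => f z i j)).
- near=> z; have Uz : U z by near: z; apply: near_open.
  by have /is_derive_mxP := smooth_is_derive fs u Uz; apply.
- near=> z; have Uz : U z by near: z; apply: near_open.
  by have /is_derive_mxP := smooth_is_derive fs v Uz; apply.
- exact: (@differentiable_comp _ _ _ _ (fun z => 'D_u f z)
      (fun N : 'M[R]_(m, k) => N i j) y (fd u) (differentiable_coord _ i j)).
- exact: (@differentiable_comp _ _ _ _ (fun z => 'D_v f z)
      (fun N : 'M[R]_(m, k) => N i j) y (fd v) (differentiable_coord _ i j)).
Unshelve. all: by end_near. Qed.

Lemma is_derive_mulmxl m k l (A : 'M[R]_(m, k)) (f : 'rV[R]_n -> 'M[R]_(k, l)) y v df :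
  is_derive y v f df -> is_derive y v (fun z => A *m f z) (A *m df).
Proof.
move=> fd; have := is_derive_mulmx (is_derive_cst A y v) fd.
by rewrite mul0mx add0r.
Qed.

Lemma is_derive_mulmxr m k l (A : 'M[R]_(k, l)) (f : 'rV[R]_n -> 'M[R]_(m, k)) y v df :
  is_derive y v f df -> is_derive y v (fun z => f z *m A) (df *m A).
Proof.
move=> fd; have := is_derive_mulmx fd (is_derive_cst A y v).
by rewrite mulmx0 addr0.
Qed.

(** The second-order information on a field that the proof uses: linearity of
    the derivative in its direction, existence of second derivatives and their
    symmetry. It passes directly to transposes and to products with a constant
    matrix. *)
Definition twice_on m k (f : 'rV[R]_n -> 'M[R]_(m, k)) : Prop :=
  forall y, U y ->
  [/\ forall a u v, 'D_(a *: u + v) f y = a *: 'D_u f y + 'D_v f y,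
      forall u, derivable f y u,
      forall u v, derivable (fun z => 'D_u f z) y v &
      forall u v, 'D_v (fun z => 'D_u f z) y = 'D_u (fun z => 'D_v f z) y].

Lemma smooth_twice m k (f : 'rV[R]_n -> 'M[R]_(m, k)) :
  smooth_on U f -> twice_on f.
Proof.
move=> fs y Uy; split=> [a u v|u|u v|u v].
- by rewrite smooth_deriveD// smooth_deriveZ.
- exact: smooth_derivable.
- exact: (@smooth_derivable _ _ (smooth_derive fs u) _ v Uy).
- exact: smooth_derive_comm.
Qed.

Lemma twice_trmx m k (f : 'rV[R]_n -> 'M[R]_(m, k)) :
  twice_on f -> twice_on (fun z => (f z)^T).
Proof.
move=> ft.
have E z u : U z -> 'D_u (fun z => (f z)^T) z = ('D_u f z)^T.
  by case/ft => _ fd _ _; have [_ ->] := is_derive_trmx (derivableP (fd u)).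
move=> y Uy; have [fl fd fdd fC] := ft y Uy.
have Eyd u v := is_derive_trmx (derivableP (fdd u v)).
have E2 u v : 'D_v (fun z => 'D_u (fun x => (f x)^T) z) y =
              ('D_v (fun z => 'D_u f z) y)^T.
  rewrite (derive_eq_on v Uy (fun z Uz => E z u Uz)).
  by have [_ ->] := Eyd u v.
split=> [a u v|u|u v|u v].
- by rewrite !E// fl linearP.
- by have [] := is_derive_trmx (derivableP (fd u)).
- by have [+ _] := Eyd u v; apply: derivable_eq_on => // z Uz; rewrite E.
- exact: (etrans (E2 u v) (etrans (congr1 trmx (fC u v)) (esym (E2 v u)))).
Qed.

Section Jacobian.
Variables (m : nat) (f : 'rV[R]_n -> 'rV[R]_m).
Hypothesis ft : twice_on f.

Lemma twice_is_derive y v : U y -> is_derive y v f ('D_v f y).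
Proof. by case/ft => _ fd _ _; apply: derivableP. Qed.

Lemma mul_Dmx y u : U y -> u *m Dmx f y = 'D_u f y.
Proof.
case/ft => fl _ _ _; have f0 : 'D_0 f y = 0 by rewrite derive0.
rewrite mulmx_sum_row {2}[u]row_sum_delta.
elim/big_rec2 : _ => [|i w _ _ ->]; first by rewrite f0.
by rewrite fl Dmx.unlock rowK.
Qed.

Lemma is_derive_Dmx y v : U y -> is_derive y v (Dmx f) ('D_v (Dmx f) y).
Proof.
move=> Uy; rewrite Dmx.unlock; apply: derivableP; apply/derivable_mxP => i j.
under [X in derivable X]eq_fun do rewrite mxE.
have [_ _ fdd _] := ft Uy.
by have /derivable_mxP := fdd (delta_mx 0 i) v; apply.
Qed.

Lemma derive_DmxE y u v : U y ->
  u *m 'D_v (Dmx f) y = 'D_v (fun z => 'D_u f z) y.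
Proof.
move=> Uy; have [_ <-] := is_derive_mulmxl u (is_derive_Dmx v Uy).
by apply: derive_eq_on => // z Uz; apply: mul_Dmx.
Qed.

(** Symmetry of second derivatives, in terms of the Jacobian matrix. *)
Lemma derive_Dmx_comm y u v : U y -> u *m 'D_v (Dmx f) y = v *m 'D_u (Dmx f) y.
Proof.
move=> Uy; have [_ _ _ fC] := ft Uy.
exact: (etrans (derive_DmxE u v Uy) (etrans (fC u v) (esym (derive_DmxE v u Uy)))).
Qed.

End Jacobian.

End OpenSet.

(** * Lie derivatives along the Reeb fields *)

Section MatrixExt.
Variable R : realType.

(** [trmx_mul] and [scalemxAr] with products in the structure of [R] as a
    semiring rather than as a commutative one, so that both sides match the
    products of the fields below syntactically. *)
Lemma tr_mulmx m n k (A : 'M[R]_(m, n)) (B : 'M[R]_(n, k)) :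
  (A *m B)^T = B^T *m A^T.
Proof. exact: trmx_mul. Qed.

Lemma scale_mulmxr m n k (a : R) (A : 'M[R]_(m, n)) (B : 'M[R]_(n, k)) :
  a *: (A *m B) = A *m (a *: B).
Proof. exact: scalemxAr. Qed.

Lemma tr_addmx m n (A B : 'M[R]_(m, n)) : (A + B)^T = A^T + B^T.
Proof. exact: linearD. Qed.

Lemma tr_scalemx m n a (A : 'M[R]_(m, n)) : (a *: A)^T = a *: A^T.
Proof. exact: linearZ. Qed.

Lemma tr_submx m n (A B : 'M[R]_(m, n)) : (A - B)^T = A^T - B^T.
Proof. exact: linearB. Qed.

Lemma tr_mx11 (A : 'M[R]_1) : A^T = A.
Proof. by apply/matrixP => i j; rewrite mxE !ord1. Qed.

Lemma row_ext m n (A B : 'M[R]_(m, n)) :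
  (forall u : 'rV_m, u *m A = u *m B) -> A = B.
Proof. by move=> AB; apply/row_matrixP => i; rewrite !rowE. Qed.

Lemma bilinear_ext m n (A B : 'M[R]_(m, n)) :
  (forall (u : 'rV_m) (v : 'rV_n), u *m A *m v^T = u *m B *m v^T) -> A = B.
Proof.
move=> AB; apply: row_ext => u; apply: trmx_inj; apply: row_ext => v.
by apply: trmx_inj; rewrite !tr_mulmx !trmxK.
Qed.

End MatrixExt.

(** The matrix of the exterior derivative of a 1-form, see [dext_atE]. *)
HB.lock Definition dform (R : realType) n (a : 'rV[R]_n -> 'cV[R]_n)
    (y : 'rV[R]_n) : 'M[R]_n :=
  2^-1 *: (Dmx (fun z => (a z)^T) y - (Dmx (fun z => (a z)^T) y)^T).

Section LieDerivative.
Variables (R : realType) (n : nat) (U : set 'rV[R]_n).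
Hypothesis Uopen : open U.
Implicit Types (y u v w : 'rV[R]_n).

(** Components of the Lie derivative along [Z] of a vector field, a 1-form, an
    endomorphism field and a bilinear form. *)
Definition lie_row (Z X : 'rV[R]_n -> 'rV[R]_n) y : 'rV[R]_n :=
  'D_(Z y) X y - X y *m Dmx Z y.

Definition lie_col (Z : 'rV[R]_n -> 'rV[R]_n) (a : 'rV[R]_n -> 'cV[R]_n) y :
  'cV[R]_n := 'D_(Z y) a y + Dmx Z y *m a y.

Definition lie_endo (Z : 'rV[R]_n -> 'rV[R]_n) (f : 'rV[R]_n -> 'M[R]_n) y :
  'M[R]_n := 'D_(Z y) f y - f y *m Dmx Z y + Dmx Z y *m f y.

Definition lie_form (Z : 'rV[R]_n -> 'rV[R]_n) (B : 'rV[R]_n -> 'M[R]_n) y :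
  'M[R]_n := 'D_(Z y) B y + Dmx Z y *m B y + B y *m (Dmx Z y)^T.

Lemma dform_tr a y : (dform a y)^T = - dform a y.
Proof. by rewrite dform.unlock linearZ /= linearB /= trmxK -scalerN opprB. Qed.

Lemma dext_atE a y u v : twice_on U a -> U y ->
  dext_at a y u v = (u *m dform a y *m v^T) 0 0.
Proof.
move=> at_ Uy.
have D s w : 'D_s (fun z => (w *m a z) 0 0) y =
    (s *m Dmx (fun z => (a z)^T) y *m w^T) 0 0.
  have [_ ad _ _] := at_ y Uy.
  have := is_derive_mulmxl w (derivableP (ad s)) => /is_derive_mxP/(_ 0 0)[_ ->].
  rewrite (mul_Dmx (twice_trmx Uopen at_))//.
  have [_ ->] := is_derive_trmx (derivableP (ad s)).
  by rewrite -tr_mulmx tr_mx11.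
rewrite /dext_at /dext /lie /= !derive_cst subr0 /pairing mul0mx mxE subr0.
rewrite (D u v) (D v u) dform.unlock -scale_mulmxr -scalemxAl [RHS]mxE; congr (2^-1 * _).
rewrite mulmxBr mulmxBl [RHS]mxE [X in _ = _ + X]mxE; congr (_ - _).
by rewrite -[v *m _ *m _]tr_mx11 !tr_mulmx trmxK mulmxA.
Qed.

Section Reeb.
Variables (Z : 'rV[R]_n -> 'rV[R]_n) (a : 'rV[R]_n -> 'cV[R]_n) (C : 'M[R]_1).
Hypotheses (Zt : twice_on U Z) (at_ : twice_on U a).
Hypothesis iZda : forall y, U y -> Z y *m dform a y = 0.
Hypothesis iZa : forall y, U y -> Z y *m a y = C.
Let A := Dmx (fun z => (a z)^T).

(** [Z a] is constant and [i_Z da = 0]. Here [lie_col_Reeb] is written in terms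
    of Jacobian matrices, the form in which it is differentiated below. *)
Lemma Reeb_row y : U y -> Z y *m A y + (a y)^T *m (Dmx Z y)^T = 0.
Proof.
move=> Uy; have /eqP := iZda Uy; rewrite dform.unlock -/(A y).
rewrite -scale_mulmxr scaler_eq0 invr_eq0 pnatr_eq0 /= mulmxBr subr_eq0 => /eqP ->.
rewrite -[Z y *m _]trmxK -tr_mulmx -linearD /=; apply/eqP; rewrite trmx_eq0; apply/eqP.
apply: row_ext => u; rewrite mulmx0 mulmxDr tr_mulmx trmxK !mulmxA.
rewrite (mul_Dmx Zt u Uy) (mul_Dmx (twice_trmx Uopen at_) u Uy).
have [_ ad _ _] := at_ Uy.
have [_ ->] := is_derive_trmx (derivableP (ad u)).
rewrite -[_^T *m _]tr_mx11 tr_mulmx !trmxK addrC.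
have [_ <-] := is_derive_mulmx (twice_is_derive Zt u Uy) (derivableP (ad u)).
by rewrite (derive_eq_on Uopen u Uy iZa) derive_cst.
Qed.

(** Cartan's formula [L_Z a = i_Z da + d (i_Z a)]. *)
Lemma lie_col_Reeb y : U y -> lie_col Z a y = 0.
Proof.
move=> Uy; apply: trmx_inj; rewrite trmx0 linearD /= tr_mulmx -(Reeb_row Uy).
rewrite (mul_Dmx (twice_trmx Uopen at_))//; have [_ ad _ _] := at_ Uy.
by have [_ ->] := is_derive_trmx (derivableP (ad (Z y))).
Qed.

Lemma is_derive_dform y v : U y -> is_derive y v (dform a) ('D_v (dform a) y).
Proof.
move=> Uy; rewrite dform.unlock; apply: derivableP; apply: derivableZ; apply: derivableB.
  by have [] := is_derive_Dmx (twice_trmx Uopen at_) v Uy.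
by have [] := is_derive_trmx (is_derive_Dmx (twice_trmx Uopen at_) v Uy).
Qed.

Lemma derive_dform y v : U y ->
  'D_v (dform a) y = 2^-1 *: ('D_v A y - ('D_v A y)^T).
Proof.
move=> Uy; rewrite dform.unlock; have D := is_derive_Dmx (twice_trmx Uopen at_) v Uy.
have [_ ->] // := is_deriveZ (2^-1 : R) (is_deriveB D (is_derive_trmx D)).
Qed.

(** The Lie derivative commutes with [d]: differentiating [L_Z a = 0] and
    antisymmetrizing gives [L_Z da = 0], the second derivatives of [Z] dropping
    out by symmetry. *)
Lemma lie_form_Reeb y : U y -> lie_form Z (dform a) y = 0.
Proof.
move=> Uy; have att := twice_trmx Uopen at_.
set DZ := Dmx Z y.
(* Its antisymmetric part is [lie_form Z (dform a) y]. *)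
set M := DZ *m A y + 'D_(Z y) A y + A y *m DZ^T.
have ME u v : u *m M *m v^T = - (u *m 'D_v (Dmx Z) y *m a y).
  have D := is_derive_mulmx (twice_is_derive Zt u Uy) (is_derive_Dmx att u Uy).
  have D' := is_derive_mulmx (twice_is_derive att u Uy)
                             (is_derive_trmx (is_derive_Dmx Zt u Uy)).
  have [_] := is_deriveD D D'; rewrite (derive_zero_on Uopen u Uy Reeb_row) => /esym.
  rewrite -!(mul_Dmx Zt)// -!(mul_Dmx att)// (derive_Dmx_comm Uopen att)//.
  move=> E.
  have {}E : u *m M + (a y)^T *m ('D_u (Dmx Z) y)^T = 0.
    by rewrite -[RHS]E /M /DZ /A !mulmxDr !mulmxA addrA.
  rewrite -{1}[u *m M]addr0 -(subrr ((a y)^T *m ('D_u (Dmx Z) y)^T)) addrA E sub0r.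
  rewrite mulNmx -tr_mulmx -tr_mulmx tr_mx11 mulmxA.
  by rewrite (derive_Dmx_comm Uopen Zt v u Uy).
have MT : M^T = M.
  apply: bilinear_ext => u v.
  rewrite -[u *m M^T *m v^T]tr_mx11 !tr_mulmx !trmxK mulmxA !ME.
  by rewrite (derive_Dmx_comm Uopen Zt u v Uy).
rewrite /lie_form derive_dform// dform.unlock -/(A y) -/DZ.
rewrite -scale_mulmxr -scalemxAl -!scalerDr; apply/eqP; rewrite scaler_eq0; apply/orP; right.
apply/eqP; rewrite -[RHS](subrr M) -[in X in _ = _ - X]MT /M !linearD /= !tr_mulmx trmxK.
set X := 'D_(Z y) A y; rewrite mulmxN mulmxBl !addrA.
by rewrite [LHS](ACl (3*1*5*6*2*4)).
Qed.

End Reeb.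

(** First-order analogue of [twice_on]; unlike it, stable under products of
    fields. *)
Definition lin_derivable m k (f : 'rV[R]_n -> 'M[R]_(m, k)) y : Prop :=
  exists2 df, (forall u, is_derive y u f (df u)) &
              forall a u v, df (a *: u + v) = a *: df u + df v.

Lemma twice_lin_derivable m k (f : 'rV[R]_n -> 'M[R]_(m, k)) y :
  twice_on U f -> U y -> lin_derivable f y.
Proof.
move=> ft /ft[fl fd _ _]; by exists (fun u => 'D_u f y) => // u.
Qed.

Lemma lin_derivableZ m k (f : 'rV[R]_n -> 'M[R]_(m, k)) y a u :
  lin_derivable f y -> 'D_(a *: u) f y = a *: 'D_u f y.
Proof.
case=> df fd dfl; have [_ ->] := fd u; have [_ ->] := fd (a *: u).
have df0 : df 0 = 0 by have := derive0 f y; have [_ ->] := fd 0.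
by have := dfl a u 0; rewrite df0 !addr0.
Qed.

Lemma lin_derivable_mulmx m k l (f : 'rV[R]_n -> 'M[R]_(m, k))
    (g : 'rV[R]_n -> 'M[R]_(k, l)) y :
  lin_derivable f y -> lin_derivable g y ->
  lin_derivable (fun z => f z *m g z) y.
Proof.
move=> [df fd dfl] [dg gd dgl]; exists (fun u => df u *m g y + f y *m dg u).
  by move=> u; apply: is_derive_mulmx.
move=> a u v; rewrite dfl dgl mulmxDl mulmxDr -scalemxAl -scale_mulmxr scalerDr.
by rewrite addrACA.
Qed.

Lemma lin_derivableD m k (f g : 'rV[R]_n -> 'M[R]_(m, k)) y :
  lin_derivable f y -> lin_derivable g y ->
  lin_derivable (fun z => f z + g z) y.
Proof.
move=> [df fd dfl] [dg gd dgl]; exists (fun u => df u + dg u).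
  by move=> u; apply: is_deriveD.
by move=> a u v; rewrite dfl dgl scalerDr addrACA.
Qed.

Lemma lin_derivableN m k (f : 'rV[R]_n -> 'M[R]_(m, k)) y :
  lin_derivable f y -> lin_derivable (fun z => - f z) y.
Proof.
move=> [df fd dfl]; exists (fun u => - df u).
  by move=> u; apply: is_deriveN.
by move=> a u v; rewrite dfl opprD scalerN.
Qed.

Lemma smooth_cst (W : normedModType R) (a : W) : smooth_on U (cst a).
Proof.
move=> k; elim: k a => [|k IH] a /=; first by move=> y _; exact: cst_continuous.
split=> [y _|v]; first exact: differentiable_cst.
rewrite (_ : (fun y => _) = cst 0) ?funeqE// => y; exact: derive_cst.
Qed.

(** The vanishing of the Nijenhuis torsion on a constant field and on [Z] reads
    [J (L_Z J) = e L_W J] when [J Z = e W]. *)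
Lemma lie_endo_torsion (J : 'rV[R]_n -> 'M[R]_n) (Z W : 'rV[R]_n -> 'rV[R]_n)
    (e : R) y :
  lin_derivable J y -> smooth_on U Z -> twice_on U W ->
  (forall z, U z -> Z z *m J z = e *: W z) -> integrable_on U J -> U y ->
  lie_endo Z J y *m J y = e *: lie_endo W J y.
Proof.
move=> Jl Zs Wt ZJ intJ Uy; have Zt := smooth_twice Uopen Zs.
apply: row_ext => u.
have dJ w : 'D_w (fun z => u *m J z) y = u *m 'D_w J y.
  case: (Jl) => df Jd _; have [_ ->] := Jd w.
  by have [_ ->] := is_derive_mulmxl u (Jd w).
have dZJ w : 'D_w (fun z => Z z *m J z) y = e *: (w *m Dmx W y).
  rewrite (derive_eq_on Uopen w Uy ZJ) (mul_Dmx Wt w Uy).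
  by have [_ Wd _ _] := Wt y Uy; have [_ ->] := is_deriveZ e (derivableP (Wd w)).
have := intJ _ _ (smooth_cst u) Zs y Uy; rewrite /nijenhuis /lie.
have dJ' w : 'D_w (fun z => cst u z *m J z) y = u *m 'D_w J y := dJ w.
rewrite !dJ' !dZJ !derive_cst !subr0 (ZJ y Uy) -!(mul_Dmx Zt _ Uy).
rewrite /= (lin_derivableZ e (W y) Jl) => N0.
apply/eqP; rewrite -subr_eq0 -[X in _ == X]N0 /lie_endo; apply/eqP.
set A := Dmx Z y; set B := Dmx W y; set C := J y; set P := 'D_(Z y) J y; set Q := 'D_(W y) J y.
clearbody A B C P Q.
rewrite -!scale_mulmxr -!scalemxAl !mulmxDl !mulmxDr !mulNmx !mulmxN !mulmxA.
rewrite !scalerDr !scalerN !opprD !opprK !addrA.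
by rewrite [LHS](ACl (3*5*4*2*1*6)).
Qed.

End LieDerivative.

(** * The Reeb fields are Killing fields *)

Section Killing.
Variables (R : realType) (n : nat) (U : set 'rV[R]_n).
Hypothesis Uopen : open U.
Variables (phi : 'rV[R]_n -> 'M[R]_n) (Z1 Z2 : 'rV[R]_n -> 'rV[R]_n).
Variables (a1 a2 : 'rV[R]_n -> 'cV[R]_n) (G : 'rV[R]_n -> 'M[R]_n).
Hypotheses (phi_s : smooth_on U phi) (Z1_s : smooth_on U Z1) (Z2_s : smooth_on U Z2).
Hypotheses (a1_s : smooth_on U a1) (a2_s : smooth_on U a2) (G_s : smooth_on U G).
Hypotheses (Z1a1 : forall y, U y -> Z1 y *m a1 y = 1%:M)
  (Z2a2 : forall y, U y -> Z2 y *m a2 y = 1%:M)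
  (Z2a1 : forall y, U y -> Z2 y *m a1 y = 0)
  (Z1a2 : forall y, U y -> Z1 y *m a2 y = 0).
Hypotheses (Z1da1 : forall y, U y -> Z1 y *m dform a1 y = 0)
  (Z2da1 : forall y, U y -> Z2 y *m dform a1 y = 0)
  (Z1da2 : forall y, U y -> Z1 y *m dform a2 y = 0)
  (Z2da2 : forall y, U y -> Z2 y *m dform a2 y = 0).
Hypothesis Z1Z2 : forall y, U y -> lie Z1 Z2 y = 0.
Hypotheses (phi2 : forall y, U y ->
    phi y *m phi y = - 1%:M + a1 y *m Z1 y + a2 y *m Z2 y)
  (Z1phi : forall y, U y -> Z1 y *m phi y = 0).
Hypotheses (G_sym : forall y, U y -> (G y)^T = G y)
  (Gphi : forall y, U y -> G y *m (phi y)^T = dform a1 y + dform a2 y)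
  (GZ1 : forall y, U y -> G y *m (Z1 y)^T = a1 y)
  (GZ2 : forall y, U y -> G y *m (Z2 y)^T = a2 y).

Let a1_t := smooth_twice Uopen a1_s.
Let a2_t := smooth_twice Uopen a2_s.
Let Z1_t := smooth_twice Uopen Z1_s.
Let Z2_t := smooth_twice Uopen Z2_s.
Let phi_t := smooth_twice Uopen phi_s.
Let G_t := smooth_twice Uopen G_s.

Lemma lie_row_self Z y : twice_on U Z -> U y -> lie_row Z Z y = 0.
Proof. by move=> Zt Uy; rewrite /lie_row (mul_Dmx Zt (Z y) Uy) subrr. Qed.

Lemma lie_row_lie Z W y : twice_on U Z -> U y -> lie_row Z W y = lie Z W y.
Proof. by move=> Zt Uy; rewrite /lie_row /lie (mul_Dmx Zt (W y) Uy). Qed.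

(** [a1 (phi u) = g(phi u, Z1)] is the contraction of [da1 + da2] with [Z1]. *)
Lemma phi_a1 y : U y -> phi y *m a1 y = 0.
Proof.
move=> Uy; rewrite -(GZ1 Uy); apply: trmx_inj; rewrite trmx0 !tr_mulmx trmxK.
by rewrite (G_sym Uy) -mulmxA (Gphi Uy) mulmxDr (Z1da1 Uy) (Z1da2 Uy) addr0.
Qed.

Lemma phi_a2 y : U y -> phi y *m a2 y = 0.
Proof.
move=> Uy; rewrite -(GZ2 Uy); apply: trmx_inj; rewrite trmx0 !tr_mulmx trmxK.
by rewrite (G_sym Uy) -mulmxA (Gphi Uy) mulmxDr (Z2da1 Uy) (Z2da2 Uy) addr0.
Qed.

(** The second hypothesis says that [L_Z B = 0]. *)
Lemma lie_endoD Z (f B : 'rV[R]_n -> 'M[R]_n) y df :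
  is_derive y (Z y) f df ->
  is_derive y (Z y) B (B y *m Dmx Z y - Dmx Z y *m B y) ->
  lie_endo Z (fun z => f z + B z) y = lie_endo Z f y.
Proof.
move=> fd Bd; rewrite /lie_endo; have [_ ->] := fd; have [_ ->] := is_deriveD fd Bd.
move: (Dmx Z y) (f y) (B y) => D F C; rewrite mulmxDl mulmxDr opprD !addrA.
rewrite [LHS](ACl (1*4*6*(2*5)*(7*3))) /=.
by rewrite !subrr !addr0.
Qed.

Lemma invariant_tensor Z (a : 'rV[R]_n -> 'cV[R]_n) (W : 'rV[R]_n -> 'rV[R]_n) y :
  twice_on U a -> twice_on U W -> U y -> lie_col Z a y = 0 -> lie_row Z W y = 0 ->
  is_derive y (Z y) (fun z => a z *m W z)
    (a y *m W y *m Dmx Z y - Dmx Z y *m (a y *m W y)).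
Proof.
move=> at_ Wt Uy /eqP; rewrite addr_eq0 => /eqP aE /eqP; rewrite subr_eq0 => /eqP WE.
have [_ ad _ _] := at_ y Uy.
have := is_derive_mulmx (derivableP (ad (Z y))) (twice_is_derive Wt (Z y) Uy).
by rewrite aE WE mulNmx addrC !mulmxA.
Qed.

Section Invariant.
Variable Z : 'rV[R]_n -> 'rV[R]_n.
Hypotheses (Za1 : forall y, U y -> lie_col Z a1 y = 0)
  (Za2 : forall y, U y -> lie_col Z a2 y = 0)
  (ZZ1 : forall y, U y -> lie_row Z Z1 y = 0)
  (ZZ2 : forall y, U y -> lie_row Z Z2 y = 0).

Lemma lie_endo_J y : U y ->
  lie_endo Z (fun y => phi y - a2 y *m Z1 y + a1 y *m Z2 y) y = lie_endo Z phi y.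
Proof.
move=> Uy; have [_ pd _ _] := phi_t Uy.
have D1 := invariant_tensor a2_t Z1_t Uy (Za2 Uy) (ZZ1 Uy).
have D2 := invariant_tensor a1_t Z2_t Uy (Za1 Uy) (ZZ2 Uy).
have D0 := derivableP (pd (Z y)).
rewrite (lie_endoD (is_deriveB D0 D1) D2).
rewrite (lie_endoD D0 (_ : is_derive _ _ (fun z => - (a2 z *m Z1 z)) _))//.
apply: is_derive_eq (is_deriveN D1) _.
by rewrite opprB mulNmx mulmxN opprK addrC.
Qed.

Lemma lie_endo_T y : U y ->
  lie_endo Z (fun y => phi y + a2 y *m Z1 y - a1 y *m Z2 y) y = lie_endo Z phi y.
Proof.
move=> Uy; have [_ pd _ _] := phi_t Uy.
have D1 := invariant_tensor a2_t Z1_t Uy (Za2 Uy) (ZZ1 Uy).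
have D2 := invariant_tensor a1_t Z2_t Uy (Za1 Uy) (ZZ2 Uy).
have D0 := derivableP (pd (Z y)).
rewrite (lie_endoD (is_deriveD D0 D1) (_ : is_derive _ _ (fun z => - (a1 z *m Z2 z)) _)).
  exact: lie_endoD D0 D1.
apply: is_derive_eq (is_deriveN D2) _.
by rewrite opprB mulNmx mulmxN opprK addrC.
Qed.

Lemma lie_endo_phi_a y : U y ->
  lie_endo Z phi y *m a1 y = 0 /\ lie_endo Z phi y *m a2 y = 0.
Proof.
move=> Uy; have [_ pd _ _] := phi_t Uy; have D0 := derivableP (pd (Z y)).
suff H a : twice_on U a -> lie_col Z a y = 0 -> (forall z, U z -> phi z *m a z = 0) ->
    lie_endo Z phi y *m a y = 0.
  by split; apply: H => //; [exact: Za1|exact: phi_a1|exact: Za2|exact: phi_a2].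
move=> at_ /eqP; rewrite addr_eq0 => /eqP aE pa.
have [_ ad _ _] := at_ y Uy.
have [_] := is_derive_mulmx D0 (derivableP (ad (Z y))).
rewrite (derive_zero_on Uopen (Z y) Uy pa) aE mulmxN => E.
by rewrite /lie_endo mulmxDl mulmxBl -!mulmxA (pa y Uy) mulmx0 addr0 -E.
Qed.

(** The identities [g(., phi .) = da1 + da2] and [g(., Z_i) = a_i] determine [g],
    since the image of [phi], [Z1] and [Z2] span; so [g] is invariant along [Z]
    as soon as all the other tensors are. *)
Lemma lie_form_G y : U y -> lie_form Z (dform a1) y = 0 ->
  lie_form Z (dform a2) y = 0 -> lie_endo Z phi y = 0 -> lie_form Z G y = 0.
Proof.
move=> Uy L1 L2 Lphi; have [_ pd _ _] := phi_t Uy; have [_ Gd _ _] := G_t Uy.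
have DG := derivableP (Gd (Z y)).
set K := lie_form Z G y.
have KE : 'D_(Z y) G y = K - (Dmx Z y *m G y + G y *m (Dmx Z y)^T).
  by rewrite /K /lie_form -[X in X - _]addrA addrK.
clearbody K.
have KZ (W : 'rV[R]_n -> 'rV[R]_n) (a : 'rV[R]_n -> 'cV[R]_n) : twice_on U W ->
    lie_col Z a y = 0 -> lie_row Z W y = 0 ->
    (forall z, U z -> G z *m (W z)^T = a z) -> K *m (W y)^T = 0.
  move=> Wt /eqP; rewrite addr_eq0 => /eqP aE /eqP; rewrite subr_eq0 => /eqP WE GW.
  have [_] := is_derive_mulmx DG (is_derive_trmx (twice_is_derive Wt (Z y) Uy)).
  rewrite (derive_eq_on Uopen (Z y) Uy GW) aE WE KE tr_mulmx.
  rewrite mulmxBl mulmxDl -!mulmxA (GW y Uy) => /eqP.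
  by rewrite opprD addrA subrK eq_sym -subr_eq0 opprK addrNK => /eqP.
have Kphi : K *m (phi y)^T = 0.
  have [_] := is_derive_mulmx DG (is_derive_trmx (derivableP (pd (Z y)))).
  rewrite (derive_eq_on Uopen (Z y) Uy Gphi).
  have [_ ->] := is_deriveD (is_derive_dform Uopen a1_t (Z y) Uy)
                            (is_derive_dform Uopen a2_t (Z y) Uy).
  have {Lphi} -> : 'D_(Z y) phi y = phi y *m Dmx Z y - Dmx Z y *m phi y.
    apply/eqP; rewrite -subr_eq0 opprB addrA -[X in _ == X]Lphi; apply/eqP.
    by rewrite /lie_endo addrAC.
  move: L1 L2; rewrite /lie_form KE -!addrA.
  move=> /eqP; rewrite addr_eq0 => /eqP -> /eqP; rewrite addr_eq0 => /eqP ->.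
  have : G y *m (phi y)^T = dform a1 y + dform a2 y by exact: Gphi.
  move: (dform a1 y) (dform a2 y) (Dmx Z y) (phi y) (G y) => A B D P F FP.
  have -> : - (D *m A + A *m D^T) - (D *m B + B *m D^T) =
      - (D *m (F *m P^T) + F *m P^T *m D^T).
    by rewrite FP mulmxDr mulmxDl -opprD addrACA.
  rewrite tr_submx !tr_mulmx mulmxBl mulmxBr mulmxDl !mulmxA.
  move: (K *m P^T) (D *m F *m P^T) (F *m D^T *m P^T) (F *m P^T *m D^T) => a b c d.
  rewrite opprD opprD addrA addrA subrK => /eqP.
  by rewrite -addrA eq_sym -subr_eq0 addrK => /eqP.
have : K *m (phi y *m phi y)^T = 0 by rewrite tr_mulmx mulmxA Kphi mul0mx.
rewrite (phi2 Uy) !linearD /= linearN /= trmx1 !tr_mulmx mulmxN mulmx1 !mulmxA.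
rewrite (KZ Z1 a1 Z1_t (Za1 Uy) (ZZ1 Uy) GZ1) (KZ Z2 a2 Z2_t (Za2 Uy) (ZZ2 Uy) GZ2).
rewrite !mul0mx !addr0.
by move/eqP; rewrite oppr_eq0 => /eqP.
Qed.

End Invariant.
Hypotheses
  (int_J : integrable_on U (fun y => phi y - a2 y *m Z1 y + a1 y *m Z2 y))
  (int_T : integrable_on U (fun y => phi y + a2 y *m Z1 y - a1 y *m Z2 y)).

Lemma lie_col_a y : U y ->
  [/\ lie_col Z1 a1 y = 0, lie_col Z1 a2 y = 0,
      lie_col Z2 a1 y = 0 & lie_col Z2 a2 y = 0].
Proof.
move=> Uy; split.
- exact: (lie_col_Reeb Uopen Z1_t a1_t Z1da1 Z1a1 Uy).
- exact: (lie_col_Reeb Uopen Z1_t a2_t Z1da2 Z1a2 Uy).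
- exact: (lie_col_Reeb Uopen Z2_t a1_t Z2da1 Z2a1 Uy).
- exact: (lie_col_Reeb Uopen Z2_t a2_t Z2da2 Z2a2 Uy).
Qed.

Lemma lie_row_Z y : U y ->
  [/\ lie_row Z1 Z1 y = 0, lie_row Z1 Z2 y = 0,
      lie_row Z2 Z1 y = 0 & lie_row Z2 Z2 y = 0].
Proof.
move=> Uy; split.
- exact: lie_row_self.
- by rewrite (lie_row_lie Z2 Z1_t Uy) Z1Z2.
- rewrite (lie_row_lie Z1 Z2_t Uy) /lie -opprB.
  by have := Z1Z2 Uy; rewrite /lie => ->; rewrite oppr0.
- exact: lie_row_self.
Qed.

Let Z1a1_inv z (Uz : U z) : lie_col Z1 a1 z = 0. Proof. by case: (lie_col_a Uz). Qed.
Let Z1a2_inv z (Uz : U z) : lie_col Z1 a2 z = 0. Proof. by case: (lie_col_a Uz). Qed.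
Let Z2a1_inv z (Uz : U z) : lie_col Z2 a1 z = 0. Proof. by case: (lie_col_a Uz). Qed.
Let Z2a2_inv z (Uz : U z) : lie_col Z2 a2 z = 0. Proof. by case: (lie_col_a Uz). Qed.
Let Z1Z1_inv z (Uz : U z) : lie_row Z1 Z1 z = 0. Proof. by case: (lie_row_Z Uz). Qed.
Let Z1Z2_inv z (Uz : U z) : lie_row Z1 Z2 z = 0. Proof. by case: (lie_row_Z Uz). Qed.
Let Z2Z1_inv z (Uz : U z) : lie_row Z2 Z1 z = 0. Proof. by case: (lie_row_Z Uz). Qed.
Let Z2Z2_inv z (Uz : U z) : lie_row Z2 Z2 z = 0. Proof. by case: (lie_row_Z Uz). Qed.

(** With [L_i = L_{Z_i} phi], which is also [L_{Z_i} J] and [L_{Z_i} T], the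
    integrability of [J] and [T] gives [J L_1 = L_2] and [T L_1 = - L_2], because
    [J Z1 = Z2] and [T Z1 = - Z2]. Adding up, [phi L_1 = 0] as [J + T = 2 phi]; and
    [a_i L_1 = 0] by invariance of [a_i phi = 0]. Hence [L_1 = 0], and [L_2 = 0]. *)
Lemma lie_endo_phi y : U y -> lie_endo Z1 phi y = 0 /\ lie_endo Z2 phi y = 0.
Proof.
move=> Uy; have L f : twice_on U f -> lin_derivable f y.
  by move=> ft; apply: twice_lin_derivable ft Uy.
have A1 : lin_derivable (fun z => a1 z *m Z2 z) y.
  by apply: lin_derivable_mulmx; apply: twice_lin_derivable Uy.
have A2 : lin_derivable (fun z => a2 z *m Z1 z) y.
  by apply: lin_derivable_mulmx; apply: twice_lin_derivable Uy.
pose J y : 'M[R]_n := phi y - a2 y *m Z1 y + a1 y *m Z2 y.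
pose T y : 'M[R]_n := phi y + a2 y *m Z1 y - a1 y *m Z2 y.
have Jl : lin_derivable J y.
  exact: (lin_derivableD (lin_derivableD (L _ _ _ phi_t) (lin_derivableN A2)) A1).
have Tl : lin_derivable T y.
  exact: (lin_derivableD (lin_derivableD (L _ _ _ phi_t) A2) (lin_derivableN A1)).
have Z1J z : U z -> Z1 z *m J z = 1 *: Z2 z.
  move=> Uz; rewrite /J mulmxDr mulmxBr !mulmxA (Z1phi Uz) (Z1a1 Uz) (Z1a2 Uz).
  by rewrite mul0mx mul1mx subr0 add0r scale1r.
have Z1T z : U z -> Z1 z *m T z = -1 *: Z2 z.
  move=> Uz; rewrite /T mulmxBr mulmxDr !mulmxA (Z1phi Uz) (Z1a1 Uz) (Z1a2 Uz).
  by rewrite mul0mx mul1mx add0r sub0r scaleN1r.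
have := lie_endo_torsion Uopen Jl Z1_s Z2_t Z1J int_J Uy.
have := lie_endo_torsion Uopen Tl Z1_s Z2_t Z1T int_T Uy.
rewrite (lie_endo_J Z1a1_inv Z1a2_inv Z1Z1_inv Z1Z2_inv Uy).
rewrite (lie_endo_J Z2a1_inv Z2a2_inv Z2Z1_inv Z2Z2_inv Uy).
rewrite (lie_endo_T Z1a1_inv Z1a2_inv Z1Z1_inv Z1Z2_inv Uy).
rewrite (lie_endo_T Z2a1_inv Z2a2_inv Z2Z1_inv Z2Z2_inv Uy).
rewrite scale1r scaleN1r => ET EJ.
have [L1a1 L1a2] := lie_endo_phi_a Z1a1_inv Z1a2_inv Uy.
move: (lie_endo Z1 phi y) (lie_endo Z2 phi y) ET EJ L1a1 L1a2 => L1 L2 ET EJ L1a1 L1a2.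
have L1phi : L1 *m phi y = 0.
  move: ET EJ; rewrite /J /T !(mulmxDr, mulmxBr) !mulmxN !mulmxA L1a1 L1a2.
  rewrite !mul0mx oppr0 !addr0 => -> /eqP.
  by rewrite eq_sym -addr_eq0 -mulr2n -scaler_nat scaler_eq0 pnatr_eq0 /= => /eqP ->; rewrite oppr0.
have L10 : L1 = 0.
  have : L1 *m (phi y *m phi y) = 0 by rewrite mulmxA L1phi mul0mx.
  rewrite (phi2 Uy) !mulmxDr mulmxN mulmx1 !mulmxA L1a1 L1a2 !mul0mx !addr0.
  by move/eqP; rewrite oppr_eq0 => /eqP.
by split=> //; rewrite -EJ L10 mul0mx.
Qed.

Lemma Reeb_killing y : U y -> lie_form Z1 G y = 0 /\ lie_form Z2 G y = 0.
Proof.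
move=> Uy; have [L1 L2] := lie_endo_phi Uy; split.
  apply: (lie_form_G Z1a1_inv Z1a2_inv Z1Z1_inv Z1Z2_inv Uy) L1.
    exact: (lie_form_Reeb Uopen Z1_t a1_t Z1da1 Z1a1 Uy).
  exact: (lie_form_Reeb Uopen Z1_t a2_t Z1da2 Z1a2 Uy).
apply: (lie_form_G Z2a1_inv Z2a2_inv Z2Z1_inv Z2Z2_inv Uy) L2.
  exact: (lie_form_Reeb Uopen Z2_t a1_t Z2da1 Z2a1 Uy).
exact: (lie_form_Reeb Uopen Z2_t a2_t Z2da2 Z2a2 Uy).
Qed.

End Killing.

(** * Curvature along a Killing field *)

Section Metric.
Variables (R : realType) (n : nat) (U : set 'rV[R]_n).
Hypothesis Uopen : open U.
Variable G : 'rV[R]_n -> 'M[R]_n.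
Hypotheses (G_s : smooth_on U G) (G_sym : forall y, U y -> (G y)^T = G y)
  (G_unit : forall y, U y -> G y \in unitmx).
Implicit Types (y u v w : 'rV[R]_n).

Let G_t := smooth_twice Uopen G_s.

Lemma twice_mulmxl m k l (A : 'M[R]_(m, k)) (f : 'rV[R]_n -> 'M[R]_(k, l)) :
  twice_on U f -> twice_on U (fun z => A *m f z).
Proof.
move=> ft.
have E z u : U z -> 'D_u (fun z => A *m f z) z = A *m 'D_u f z.
  by case/ft => _ fd _ _; have [_ ->] := is_derive_mulmxl A (derivableP (fd u)).
move=> y Uy; have [fl fd fdd fC] := ft y Uy.
have Eyd u v := is_derive_mulmxl A (derivableP (fdd u v)).
have E2 u v : 'D_v (fun z => 'D_u (fun x => A *m f x) z) y =
              A *m 'D_v (fun z => 'D_u f z) y.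
  rewrite (derive_eq_on Uopen v Uy (fun z Uz => E z u Uz)).
  by have [_ ->] := Eyd u v.
split=> [a u v|u|u v|u v].
- by rewrite !E// fl mulmxDr scale_mulmxr.
- by have [] := is_derive_mulmxl A (derivableP (fd u)).
- have [+ _] := Eyd u v.
  exact: (derivable_eq_on Uopen Uy (fun z Uz => esym (E z u Uz))).
- exact: (etrans (E2 u v) (etrans (congr1 (mulmx A) (fC u v)) (esym (E2 v u)))).
Qed.

(** The matrix [w |-> Gamma(u, w)]. With the upper index lowered by [G], the
    Koszul formula gives [christoffel_low]. *)
Definition christoffel_low y u : 'M[R]_n :=
  let P := Dmx (fun z => u *m G z) y in 2^-1 *: ('D_u G y + P - P^T).

Definition christoffel_mx y u : 'M[R]_n := christoffel_low y u *m invmx (G y).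

Lemma is_derive_G y u : U y -> is_derive y u G ('D_u G y).
Proof. by case/G_t => _ Gd _ _; apply: derivableP. Qed.

Lemma derive_G_sym y u : U y -> ('D_u G y)^T = 'D_u G y.
Proof.
move=> Uy; have [_ <-] := is_derive_trmx (is_derive_G u Uy).
by rewrite (derive_eq_on Uopen u Uy G_sym).
Qed.

Lemma mul_DmxG y u w : U y -> w *m Dmx (fun z => u *m G z) y = u *m 'D_w G y.
Proof.
move=> Uy; rewrite (mul_Dmx (twice_mulmxl u G_t) w Uy).
by have [_ ->] := is_derive_mulmxl u (is_derive_G w Uy).
Qed.

Lemma derive_inner y u v w : U y ->
  'D_u (fun z => inner G z v w) y = (v *m 'D_u G y *m w^T) 0 0.
Proof.
move=> Uy.
have := is_derive_mulmxr w^T (is_derive_mulmxl v (is_derive_G u Uy)).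
by move=> /is_derive_mxP/(_ 0 0)[_ ->].
Qed.

Lemma christoffelE y u w : U y -> christoffel G y u w = w *m christoffel_mx y u.
Proof.
move=> Uy; rewrite /christoffel /christoffel_mx mulmxA; congr (_ *m _).
apply/matrixP => i j; rewrite ord1 mxE /christoffel1.
set e : 'rV[R]_n := delta_mx 0 j.
rewrite (derive_inner u w e Uy) (derive_inner w u e Uy) (derive_inner e u w Uy).
rewrite -(mul_DmxG u w Uy) -(mul_DmxG u e Uy) /christoffel_low /=.
have eE (A : 'rV[R]_n) : A 0 j = (A *m e^T) 0 0 by rewrite trmx_delta -colE mxE.
rewrite eE; move: ('D_u G y) (Dmx _ y) => D P.
rewrite -[e *m P *m w^T]tr_mx11 !tr_mulmx trmxK mulmxA.
rewrite -scale_mulmxr mulmxBr mulmxDr -scalemxAl mulmxBl mulmxDl.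
by move: (w *m D *m e^T) (w *m P *m e^T) (w *m P^T *m e^T) => a b c; rewrite !mxE.
Qed.

Lemma christoffel_mxG y u : U y -> christoffel_mx y u *m G y = christoffel_low y u.
Proof. by move=> Uy; rewrite /christoffel_mx mulmxKV// G_unit. Qed.

(** The connection is torsion-free. *)
Lemma christoffel_mx_sym y u w : U y ->
  w *m christoffel_mx y u = u *m christoffel_mx y w.
Proof.
move=> Uy; rewrite /christoffel_mx !mulmxA; congr (_ *m _).
rewrite /christoffel_low /= -!scale_mulmxr; congr (_ *: _).
have H v s : v *m (Dmx (fun z => s *m G z) y)^T = s *m (Dmx (fun z => v *m G z) y)^T.
  apply: trmx_inj; apply: row_ext => t.
  rewrite !tr_mulmx !trmxK !mulmxA (mul_DmxG s t Uy) (mul_DmxG v t Uy).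
  by rewrite -[LHS]tr_mx11 !tr_mulmx trmxK (derive_G_sym t Uy) mulmxA.
rewrite !mulmxBr !mulmxDr (H w u) (mul_DmxG u w Uy) (mul_DmxG w u Uy).
by move: (w *m 'D_u G y) (u *m 'D_w G y) => a b; rewrite [b + a]addrC.
Qed.

(** The connection preserves the metric. *)
Lemma derive_GE y u : U y ->
  'D_u G y = christoffel_mx y u *m G y + G y *m (christoffel_mx y u)^T.
Proof.
move=> Uy; rewrite -[X in _ = _ + X]trmxK tr_mulmx trmxK (G_sym Uy).
rewrite (christoffel_mxG u Uy) /christoffel_low /=.
move: (derive_G_sym u Uy) (Dmx _ y); move: ('D_u G y) => D DT P.
rewrite tr_scalemx -scalerDr tr_submx tr_addmx trmxK DT.
have -> : D + P - P^T + (D + P^T - P) = D + D.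
  by rewrite addrACA [D + P + _]addrACA -opprD [P + P^T]addrC addrK.
by rewrite scalerDr -scalerDl [_ + _](_ : _ = 1) ?scale1r//; lra.
Qed.

Lemma derivable_christoffel_mx y u v : U y -> derivable (fun z => christoffel_mx z u) y v.
Proof.
move=> Uy.
have Pd := is_derive_Dmx (twice_mulmxl u G_t) v Uy.
have [_ _ Gdd _] := G_t Uy.
have low := is_deriveZ (2^-1 : R) (is_deriveB (is_deriveD (derivableP (Gdd u v)) Pd) (is_derive_trmx Pd)).
have inv : derivable (fun z => invmx (G z)) y v.
  apply: derivable_invmx; last by have [] := is_derive_G v Uy.
  by near=> z; apply: G_unit; near: z; apply: near_open.
by have [] := is_derive_mulmx low (derivableP inv).
Unshelve. all: by end_near. Qed.

Lemma is_derive_christoffel_mx y u v : U y ->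
  is_derive y v (fun z => christoffel_mx z u) ('D_v (fun z => christoffel_mx z u) y).
Proof. by move=> Uy; apply: derivableP; apply: derivable_christoffel_mx. Qed.

Lemma curvE y u v w : U y -> curv G y u v w =
  w *m ('D_u (fun z => christoffel_mx z v) y + christoffel_mx y v *m christoffel_mx y u
   - ('D_v (fun z => christoffel_mx z u) y + christoffel_mx y u *m christoffel_mx y v)).
Proof.
move=> Uy; rewrite /curv /curvature.
have N1 s z : U z -> nabla G (cst s) (cst w) z = w *m christoffel_mx z s.
  by move=> Uz; rewrite /nabla derive_cst add0r christoffelE.
have N2 s t : nabla G (cst s) (nabla G (cst t) (cst w)) y =
   w *m ('D_s (fun z => christoffel_mx z t) y + christoffel_mx y t *m christoffel_mx y s).
  rewrite {1}/nabla (christoffelE _ _ Uy) (N1 t y Uy) mulmxDr mulmxA.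
  rewrite (derive_eq_on Uopen _ Uy (N1 t)).
  by have [_ ->] := is_derive_mulmxl w (is_derive_christoffel_mx t s Uy).
rewrite !N2 mulmxBr.
have -> : nabla G (lie (cst u) (cst v)) (cst w) y = 0.
  rewrite /nabla /lie !derive_cst subr0 add0r (christoffelE _ _ Uy).
  by rewrite (christoffel_mx_sym _ _ Uy) mul0mx.
by rewrite subr0.
Qed.

Section KillingField.
Variables (Z : 'rV[R]_n -> 'rV[R]_n) (a : 'rV[R]_n -> 'cV[R]_n).
Hypotheses (Z_t : twice_on U Z) (a_t : twice_on U a).
Hypothesis killing : forall y, U y -> lie_form Z G y = 0.
Hypothesis GZ : forall y, U y -> G y *m (Z y)^T = a y.
Hypothesis Zda : forall y, U y -> Z y *m dform a y = 0.

(** The matrix [u |-> nabla_u Z]. *)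
Definition nabla_mx y : 'M[R]_n := Dmx Z y + christoffel_mx y (Z y).

Lemma mul_nabla_mx y u : U y ->
  u *m nabla_mx y = u *m Dmx Z y + Z y *m christoffel_mx y u.
Proof. by move=> Uy; rewrite /nabla_mx mulmxDr (christoffel_mx_sym (Z y) u Uy). Qed.

(** Killing's equation. *)
Lemma nabla_mx_skew y : U y -> nabla_mx y *m G y = - (G y *m (nabla_mx y)^T).
Proof.
move=> Uy; apply/eqP; rewrite -addr_eq0 -[X in _ == X](killing Uy) /lie_form; apply/eqP.
rewrite (derive_GE (Z y) Uy) /nabla_mx mulmxDl tr_addmx mulmxDr.
move: (Dmx Z y) (christoffel_mx y (Z y)) (G y) => D C F.
move: (D *m F) (C *m F) (F *m D^T) (F *m C^T) => b c d e.
by rewrite addrACA -[RHS]addrA [RHS]addrC.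
Qed.

(** As [Z] is Killing, [g(nabla_u Z, v)] is skew in [u] and [v], hence equal to
    its antisymmetrization, which is [da(u, v)]. *)
Lemma nabla_mx_dform y : U y -> nabla_mx y *m G y = dform a y.
Proof.
move=> Uy; have aT := twice_trmx Uopen a_t.
set A := Dmx (fun z => (a z)^T) y.
have AE u : u *m A = u *m nabla_mx y *m G y + (a y)^T *m (christoffel_mx y u)^T.
  rewrite /A (mul_Dmx aT u Uy).
  have [_ ad _ _] := a_t Uy; have [_ ->] := is_derive_trmx (derivableP (ad u)).
  rewrite -(derive_eq_on Uopen u Uy GZ).
  have [_ ->] := is_derive_mulmx (is_derive_G u Uy) (is_derive_trmx (twice_is_derive Z_t u Uy)).
  rewrite (derive_GE u Uy) -(GZ Uy) -(mul_Dmx Z_t u Uy) (mul_nabla_mx u Uy).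
  move: (christoffel_mx y u) (u *m Dmx Z y) (G_sym Uy); move: (G y) => F C v FT.
  rewrite tr_addmx !tr_mulmx !trmxK tr_addmx !tr_mulmx !trmxK FT mulmxDl mulmxDr !mulmxA.
  by rewrite [LHS]addrC addrA addrAC.
have E : A - A^T = nabla_mx y *m G y + nabla_mx y *m G y.
  apply: bilinear_ext => u v.
  rewrite mulmxBr mulmxBl -[u *m A^T *m v^T]tr_mx11 !tr_mulmx !trmxK mulmxA !AE.
  have V : v *m nabla_mx y *m G y *m u^T = - (u *m nabla_mx y *m G y *m v^T).
    rewrite -[u *m nabla_mx y *m G y]mulmxA (nabla_mx_skew Uy) mulmxN mulNmx opprK.
    by rewrite -[LHS]tr_mx11 !tr_mulmx trmxK (G_sym Uy) !mulmxA.
  have W : (a y)^T *m (christoffel_mx y v)^T *m u^T =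
           (a y)^T *m (christoffel_mx y u)^T *m v^T.
    by rewrite -!mulmxA -!tr_mulmx (christoffel_mx_sym u v Uy).
  rewrite 2!mulmxDl V W mulmxDr mulmxDl !mulmxA.
  move: (u *m nabla_mx y *m G y *m v^T) (_ *m v^T) => b c.
  by rewrite opprD opprK addrACA subrr addr0.
rewrite dform.unlock -/A E scalerDr -scalerDl [_ + _](_ : _ = 1) ?scale1r//; lra.
Qed.

Lemma Z_nabla_mx y : U y -> Z y *m nabla_mx y = 0.
Proof.
move=> Uy; rewrite -[nabla_mx y](mulmxK (G_unit Uy)) (nabla_mx_dform Uy) mulmxA.
by rewrite (Zda Uy) mul0mx.
Qed.

(** For a Killing field [Z] with [nabla_Z Z = 0], [g(R(x, Z) Z, x)] is
    [|nabla_x Z|^2]. With [S = nabla Z], one has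
    [R(x, Z) Z = (nabla_x S) Z - (nabla_Z S) x]: the first term is
    [- S (nabla_x Z)] because [S Z = 0], and the second one is orthogonal to [x]
    because [S] is skew. *)
Lemma curv_killing y x : U y ->
  curv G y x (Z y) (Z y) *m G y *m x^T =
  x *m nabla_mx y *m G y *m (x *m nabla_mx y)^T.
Proof.
move=> Uy; set z := Z y.
have S_diff u v : is_derive y v (fun t => u *m nabla_mx t)
    (u *m 'D_v (Dmx Z) y + ('D_v Z y *m christoffel_mx y u
       + z *m 'D_v (fun t => christoffel_mx t u) y)).
  have D1 := is_derive_mulmxl u (is_derive_Dmx Z_t v Uy).
  have D2 := is_derive_mulmx (twice_is_derive Z_t v Uy) (is_derive_christoffel_mx u v Uy).
  apply: near_eq_is_derive (is_deriveD D1 D2).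
  near=> t; rewrite mul_nabla_mx//; near: t; exact: near_open.
have S_derivable v : derivable nabla_mx y v.
  apply/derivable_mxP => i j.
  have /is_derive_mxP/(_ 0 j)[+ _] := S_diff (delta_mx 0 i) v.
  by apply: (near_eq_derivable _); near=> t; rewrite -rowE mxE.
have SE u v : u *m 'D_v nabla_mx y = u *m 'D_v (Dmx Z) y + ('D_v Z y *m christoffel_mx y u
       + z *m 'D_v (fun t => christoffel_mx t u) y).
  have [_ <-] := S_diff u v.
  by have [_ ->] := is_derive_mulmxl u (derivableP (S_derivable v)).
(* Differentiate [Z S = 0] along [x]. *)
have zS : 'D_x Z y *m nabla_mx y + z *m 'D_x nabla_mx y = 0.
  have [_ <-] := is_derive_mulmx (twice_is_derive Z_t x Uy) (derivableP (S_derivable x)).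
  by rewrite (derive_zero_on Uopen x Uy Z_nabla_mx).
(* Differentiate [g(x S, x) = 0] along [Z]. *)
have xS : x *m 'D_z nabla_mx y *m G y *m x^T + x *m nabla_mx y *m 'D_z G y *m x^T = 0.
  have xS0 t : U t -> x *m nabla_mx t *m G t *m x^T = 0.
    move=> Ut; have : x *m nabla_mx t *m G t *m x^T = - (x *m nabla_mx t *m G t *m x^T).
      rewrite -{1}[x *m nabla_mx t *m G t]mulmxA (nabla_mx_skew Ut) mulmxN mulNmx; congr (- _).
      by rewrite -[LHS]tr_mx11 !tr_mulmx !trmxK (G_sym Ut) !mulmxA.
    move/eqP; rewrite -addr_eq0 -mulr2n -scaler_nat scaler_eq0 pnatr_eq0 /=.
    by move/eqP.
  have [_] := is_derive_mulmxr x^T (is_derive_mulmx (is_derive_mulmxl x (derivableP (S_derivable z)))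
                    (is_derive_G z Uy)).
  by rewrite (derive_zero_on Uopen z Uy xS0) mulmxDl => <-.
have sE : x *m nabla_mx y = 'D_x Z y + z *m christoffel_mx y x.
  by rewrite (mul_nabla_mx x Uy) (mul_Dmx Z_t x Uy).
have zSE : 'D_z Z y = - (z *m christoffel_mx y z).
  apply/eqP; rewrite -addr_eq0 -(mul_Dmx Z_t z Uy) -(mul_nabla_mx z Uy).
  by rewrite (Z_nabla_mx Uy).
have := nabla_mx_skew Uy; have := SE x z; have := SE z x.
rewrite (derive_Dmx_comm Uopen Z_t z x Uy) (curvE _ _ _ Uy).
move: xS zS sE; rewrite zSE (derive_GE z Uy) => {zSE SE S_derivable S_diff}.
have := G_sym Uy; have := christoffel_mx_sym z x Uy.
move: ('D_x Z y) ('D_x nabla_mx y) ('D_z nabla_mx y) ('D_x (christoffel_mx^~ z) y)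
  ('D_z (christoffel_mx^~ x) y) ('D_z (Dmx Z) y) (christoffel_mx y x)
  (christoffel_mx y z) (nabla_mx y) (G y) => d P Q Lx Lz H Cx Cz S F.
clearbody z; move=> Csym FT xS zS sE zP xQ SF.
have {xS} xQF : x *m Q *m F *m x^T =
    - (x *m S *m (Cz *m F) *m x^T + x *m S *m (F *m Cz^T) *m x^T).
  by apply/eqP; rewrite -addr_eq0 -[X in _ == X]xS mulmxDr mulmxDl.
have curvE' : z *m (Lx + Cz *m Cx - (Lz + Cx *m Cz)) =
    - (d *m S) - x *m Q - x *m S *m Cz.
  have -> : d *m S = - (z *m P) by apply/eqP; rewrite -addr_eq0 zS.
  rewrite zP xQ sE mulmxBr !mulmxDr mulmxDl !mulmxA mulNmx opprK.
  move: (x *m H) (d *m Cz) (z *m Lx) (z *m Cz *m Cx) (z *m Lz) (z *m Cx *m Cz) => h1 h2 h3 h4 h5 h6.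
  rewrite !opprD !opprK !addrA [RHS](ACl (3*5*6*8*(1*4)*(2*7))) /=.
  by rewrite !subrr !addr0.
have dSF : d *m S *m F *m x^T = - (x *m S *m F *m d^T).
  rewrite -[d *m S *m F]mulmxA SF mulmxN mulNmx; congr (- _).
  by rewrite -[LHS]tr_mx11 !tr_mulmx !trmxK FT !mulmxA.
have -> : (x *m S)^T = d^T + Cz^T *m x^T by rewrite sE tr_addmx -Csym tr_mulmx.
rewrite curvE' !mulmxBl !mulNmx dSF xQF !opprK mulmxDr !mulmxA.
by rewrite addrA [LHS]addrAC addrK.
Unshelve. all: by end_near. Qed.

End KillingField.

End Metric.

(** * Wedge powers of a 2-form and its rank *)

Section Alternation.
Variables (R : realType) (n : nat).

Lemma wedge_row_perm k l (w : kform R n k) (h : kform R n l) (t : 'S_(k + l)) A :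
  wedge w h (row_perm t A) = (-1) ^+ t * wedge w h A.
Proof.
rewrite /wedge mulrCA; congr (_ * _).
rewrite (reindex_inj (mulIg t^-1)%g) /= mulr_sumr; apply: eq_bigr => s _.
rewrite -row_permM mulgKV odd_permM odd_permV signr_addb.
by rewrite -mulrA mulrCA.
Qed.

Lemma wedge_pow_row_perm (w : kform R n 2) m (t : 'S_(m * 2)) A :
  wedge_pow w m (row_perm t A) = (-1) ^+ t * wedge_pow w m A.
Proof.
case: m t A => [|m] t A; last exact: (@wedge_row_perm 2 (m * 2)).
by rewrite (_ : t = 1%g) ?odd_perm1 ?mul1r//; apply/permP => -[].
Qed.

End Alternation.

Section Symplectic.

(** The partner of an index in the pairing [(0, 1), (2, 3), ...]. *)
Definition partner (i : nat) : nat := if odd i then i.-1 else i.+1.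

Variable R : realType.

(** The Gram matrix of a symplectic family [e_0, f_0, e_1, f_1, ...]. *)
Definition symp (i j : nat) : R := (-1) ^+ odd i * (j == partner i)%:R.

Definition symp_mx N : 'M[R]_N := \matrix_(i < N, j < N) symp i j.

Lemma partner_double k : partner k.*2 = k.*2.+1.
Proof. by rewrite /partner odd_double. Qed.

Lemma partner_doubleS k : partner k.*2.+1 = k.*2.
Proof. by rewrite /partner /= odd_double. Qed.

Lemma pairP i : (exists k, i = k.*2) \/ (exists k, i = k.*2.+1).
Proof.
rewrite -(odd_double_half i); case: odd; first by right; exists i./2.
by left; exists i./2.
Qed.

Lemma partnerK i : partner (partner i) = i.
Proof.
by case: (pairP i) => -[k ->]; rewrite ?(partner_double, partner_doubleS).
Qed.

Lemma odd_partner i : odd (partner i) = ~~ odd i.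
Proof.
by case: (pairP i) => -[k ->];
  rewrite ?(partner_double, partner_doubleS) /= odd_double.
Qed.

Lemma partner_lt m (i : 'I_(m * 2)) : (partner i < m * 2)%N.
Proof.
have := ltn_ord i; case: (pairP i) => -[k ->];
  rewrite ?(partner_double, partner_doubleS); lia.
Qed.

Lemma symp_mx_sqr m : symp_mx (m * 2) *m symp_mx (m * 2) = - 1%:M.
Proof.
apply/matrixP => i j; rewrite !mxE (bigD1 (Ordinal (partner_lt i))) //= big1.
  rewrite !mxE /symp /= eqxx mulr1 partnerK addr0 mulrA -signr_addb.
  by rewrite odd_partner addbN addbb expr1 mulN1r eq_sym.
move=> l li; rewrite !mxE /symp (_ : (l == partner i :> nat) = false) ?mulr0 ?mul0r//.
by apply: contraNF li => /eqP li; apply/eqP/val_inj.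
Qed.

(** Splitting off the value at [0] gives access to [odd_lift_perm]. *)
Lemma perm_lift N (s : 'S_N.+1) : exists s', s = lift_perm ord0 (s ord0) s'.
Proof.
pose f k := odflt k (unlift (s ord0) (s (lift ord0 k))).
have fK k : lift (s ord0) (f k) = s (lift ord0 k).
  rewrite /f; have := neq_lift ord0 k.
  by rewrite -(can_eq (permK s)) => /unlift_some[] ? ? ->.
have fI : injective f.
  move=> k l /(congr1 (lift (s ord0))); rewrite !fK => /perm_inj; exact: lift_inj.
exists (perm fI); apply/permP => k.
case: (unliftP ord0 k) => [k'|] ->; rewrite ?lift_perm_id//.
by rewrite lift_perm_lift permE fK.
Qed.

Variables (n : nat) (B : 'M[R]_n).

Definition form_of (u v : 'rV[R]_n) : R := (u *m B *m v^T) 0 0.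

Lemma form_row m (A : 'M[R]_(m, n)) i j :
  form_of (row i A) (row j A) = (A *m B *m A^T) i j.
Proof.
by rewrite /form_of -!row_mul !mxE; apply: eq_bigr => k _; rewrite !mxE.
Qed.

Lemma wedge_powS m (w : kform R n 2) (A : 'M[R]_(m.+1 * 2, n)) :
  wedge_pow w m.+1 A = (2 + m * 2)`!%:R^-1 *
    \sum_(s : 'S_(2 + m * 2)) (-1) ^+ s *
      (w (@usubmx _ 2 (m * 2) _ (row_perm s A)) *
       wedge_pow w m (@dsubmx _ 2 (m * 2) _ (row_perm s A))).
Proof. by []. Qed.

(** Deleting the pair [(2a, 2a+1)] from the indices. *)
Definition skip_pair (a k : nat) : nat := if (a.*2 <= k)%N then k.+2 else k.

Lemma symp_skip_pair a k l : symp (skip_pair a k) (skip_pair a l) = symp k l.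
Proof.
have osk : odd (skip_pair a k) = odd k by rewrite /skip_pair; case: ifP => //=; rewrite negbK.
have psk : partner (skip_pair a k) = skip_pair a (partner k).
  rewrite /partner osk /skip_pair; case: (pairP k) => -[c ->]; rewrite /= odd_double /=;
    do ![case: ifP] => //=; lia.
rewrite /symp osk psk; congr (_ * (nat_of_bool _)%:R).
by rewrite /skip_pair; apply/eqP/eqP; do ![case: ifP]; lia.
Qed.

Lemma bump_pair i j : bump i j = partner i ->
  exists2 a, j = a.*2 & forall k, bump i (bump j k) = skip_pair a k.
Proof.
case: (pairP i) => -[a ->]; rewrite ?(partner_double, partner_doubleS) => E;
  (have jE : j = a.*2 by move: E; rewrite /bump; lia);
  by exists a => // k; rewrite jE /bump /skip_pair; case: ifP; lia.
Qed.

(** No cancellation occurs in the sum over permutations [s]: a factor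
    [b(A_{s 0}, A_{s 1})] is nonzero only if [s 0] and [s 1] are partners. The
    remaining rows are then those of a shorter symplectic family, in an order
    whose sign is the sign of [s] times this factor. *)
Lemma wedge_pow_gt0 m (A : 'M[R]_(m * 2, n)) :
  A *m B *m A^T = symp_mx (m * 2) ->
  0 < wedge_pow (kform2 form_of) m A.
Proof.
elim: m A => [|m IH] A AJ; first exact: ltr01.
have b i j : form_of (row i A) (row j A) = symp i j by rewrite form_row AJ mxE.
rewrite wedge_powS mulr_gt0 ?invr_gt0 ?ltr0n ?fact_gt0//.
pose T (s : 'S_(m * 2).+2) : R := (-1) ^+ s *
      (kform2 form_of (@usubmx _ 2 (m * 2) _ (row_perm s A)) *
       wedge_pow (kform2 form_of) m (@dsubmx _ 2 (m * 2) _ (row_perm s A))).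
have term (s : 'S_(m * 2).+2) :
    if val (s (lift ord0 ord0)) == partner (val (s ord0)) then 0 < T s else T s == 0.
  have bT : kform2 form_of (@usubmx _ 2 (m * 2) _ (row_perm s A)) =
            symp (s ord0) (s (lift ord0 ord0)).
    rewrite -b /kform2; congr form_of; apply/rowP => k; rewrite !mxE.
      by congr (A (s _) k); apply: val_inj.
    by congr (A (s _) k); apply: val_inj.
  case: ifP => [/eqP sP|sP]; last first.
    by rewrite /T bT /symp sP mulr0 mul0r mulr0 eqxx.
  have [s' sE] := perm_lift s; have [s'' s'E] := perm_lift s'.
  move: (s ord0) (s' ord0) sE s'E sP bT => i j sE s'E.
  have -> : s (lift ord0 ord0) = lift i j by rewrite sE lift_perm_lift s'E lift_perm_id.
  move=> /= ij bT; have [a jE skip] := bump_pair ij.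
  rewrite /T bT.
  pose A' := (\matrix_k row (lift i (lift j k)) A : 'M[R]_(m * 2, n)).
  have -> : @dsubmx _ 2 (m * 2) _ (row_perm s A) = row_perm s'' A'.
    apply/matrixP => k l; rewrite !mxE.
    have -> : rshift 2 k = lift ord0 (lift ord0 k) :> 'I_(m * 2).+2 by apply: val_inj.
    by rewrite sE lift_perm_lift s'E lift_perm_lift.
  rewrite wedge_pow_row_perm.
  have A'J : A' *m B *m A'^T = symp_mx (m * 2).
    apply/matrixP => k l; rewrite -form_row !rowK b mxE /=.
    by rewrite !skip symp_skip_pair.
  suff -> : forall x, (-1) ^+ s * (symp i (lift i j) * ((-1) ^+ s'' * x)) = x.
    exact: IH.
  have odd_s : odd_perm s = odd i (+) odd_perm s''.
    by rewrite sE odd_lift_perm s'E odd_lift_perm jE odd_double.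
  move=> x; rewrite /symp /= ij eqxx mulr1 odd_s !mulrA -!signr_addb.
  by case: (odd i); case: (odd_perm s''); rewrite ?expr0 ?mul1r.
rewrite (bigD1 1%g) //= ltr_pwDl//.
  by have := term 1%g; rewrite !perm1.
apply: sumr_ge0 => s _; have := term s; case: ifP => _; first exact: ltW.
by move=> /eqP E; change (0 <= T s); rewrite E.
Qed.

Hypothesis B_skew : B^T = - B.

Lemma form_skew (u v : 'rV[R]_n) : v *m B *m u^T = - (u *m B *m v^T).
Proof. by rewrite -[LHS]tr_mx11 !tr_mulmx trmxK B_skew mulNmx mulmxN mulmxA. Qed.

Lemma symplectic_extend m (A : 'M[R]_(m * 2, n)) (e f : 'rV[R]_n) :
  A *m B *m A^T = symp_mx (m * 2) -> e *m B *m A^T = 0 -> f *m B *m A^T = 0 ->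
  e *m B *m f^T = 1%:M ->
  let A' := col_mx (col_mx e f) A in A' *m B *m A'^T = symp_mx (1 + 1 + m * 2).
Proof.
move=> AJ eA fA ef A'.
have self (u : 'rV[R]_n) : u *m B *m u^T = 0.
  have /eqP := form_skew u u.
  by rewrite -addr_eq0 -mulr2n -scaler_nat scaler_eq0 pnatr_eq0 /= => /eqP.
have fe : f *m B *m e^T = - 1%:M by rewrite form_skew ef.
have Ae : A *m B *m e^T = 0.
  apply: trmx_inj; rewrite !tr_mulmx trmxK B_skew mulNmx mulmxN mulmxA eA.
  by rewrite trmx0 oppr0.
have Af : A *m B *m f^T = 0.
  apply: trmx_inj; rewrite !tr_mulmx trmxK B_skew mulNmx mulmxN mulmxA fA.
  by rewrite trmx0 oppr0.
have A'B : A' *m B = col_mx (col_mx (e *m B) (f *m B)) (A *m B).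
  by rewrite /A' !mul_col_mx.
rewrite A'B /A' !tr_col_mx !mul_col_row mul_col_mx mul_mx_row.
rewrite !self ef fe Ae Af eA fA AJ col_mx0 row_mx0.
apply/matrixP => i j; rewrite !mxE.
case: splitP => i' iE; rewrite !mxE; case: splitP => j' jE; rewrite !mxE iE jE.
- case: splitP => i1 i1E; rewrite !mxE; case: splitP => j1 j1E; rewrite !mxE i1E j1E.
  + by rewrite !ord1 /symp mulr0.
  + by rewrite !ord1 /symp mulr1.
  + by rewrite !ord1 /symp expr1 mulr1.
  + by rewrite !ord1 /symp mulr0.
- rewrite /symp (_ : (_ == _) = false) ?mulr0//; apply/negbTE/eqP.
  by have := ltn_ord i'; rewrite /partner; case: ifP; lia.
- rewrite /symp (_ : (_ == _) = false) ?mulr0//; apply/negbTE/eqP.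
  by have := ltn_ord j'; rewrite /partner /=; case: ifP; case: (nat_of_ord i') => //=; lia.
- by rewrite -(symp_skip_pair 0 i' j').
Qed.

(** A 2-form whose [k]-th power vanishes has no symplectic family of [2k]
    vectors, by [wedge_pow_gt0]. Hence extending such a family inside [H] two
    vectors at a time gets stuck before that length: a vector [e] of [H]
    orthogonal to the family, which exists by counting dimensions, then has no
    partner, that is, [b(e, f) = 0] for all [f] in [H]. *)
Lemma wedge_pow_radical k h (H : 'M[R]_(h, n)) :
  (k.*2 <= \rank H)%N -> (forall A, wedge_pow (kform2 form_of) k A = 0) ->
  exists x : 'rV[R]_n, [/\ (x <= H)%MS, x != 0 &
    forall v : 'rV[R]_n, (v <= H)%MS -> x *m B *m v^T = 0].
Proof.
move=> kH b0; apply: contrapT => noX.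
suff [A [_ /wedge_pow_gt0]] : exists A : 'M[R]_(k * 2, n),
    (A <= H)%MS /\ A *m B *m A^T = symp_mx (k * 2) by rewrite b0 ltxx.
suff ext m : (m <= k)%N -> exists A : 'M[R]_(m * 2, n),
    (A <= H)%MS /\ A *m B *m A^T = symp_mx (m * 2) by exact: ext.
elim: m => [_|m IH mk].
  by exists 0; rewrite sub0mx mul0mx mul0mx; split=> //; apply/matrixP => -[].
have [A [AH AJ]] := IH (ltnW mk).
have /rowV0Pn[e] : (H :&: kermx (B *m A^T))%MS != 0.
  rewrite -mxrank_eq0 -lt0n.
  have := mxrank_sum_cap H (kermx (B *m A^T)); rewrite mxrank_ker.
  have := rank_leq_col (H + kermx (B *m A^T))%MS.
  have := rank_leq_col (B *m A^T); have := rank_leq_row (B *m A^T).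
  lia.
rewrite sub_capmx => /andP[eH /sub_kermxP eA] e0; rewrite mulmxA in eA.
have [f0 [f0H ef0]] : exists f : 'rV_n, (f <= H)%MS /\ e *m B *m f^T != 0.
  apply: contrapT => no_f; apply: noX; exists e; split=> // v vH.
  by apply: contrapT => /eqP ev; apply: no_f; exists v.
(* The component of [f0] orthogonal to the family; [- symp_mx] is the inverse
   Gram matrix. *)
pose f1 := f0 + f0 *m B *m A^T *m symp_mx (m * 2) *m A.
have f1A : f1 *m B *m A^T = 0.
  rewrite /f1 !mulmxDl -!mulmxA [A *m (B *m A^T)]mulmxA AJ symp_mx_sqr.
  by rewrite !mulmxN mulmx1 subrr.
have ef1 : e *m B *m f1^T = e *m B *m f0^T.
  rewrite /f1 linearD /= tr_mulmx mulmxDr mulmxA eA.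
  by rewrite mul0mx addr0.
set c := (e *m B *m f0^T) 0 0.
have cE : e *m B *m f0^T = c%:M by rewrite [LHS]mx11_scalar.
have c0 : c != 0 by apply: contraNneq ef0 => c0; rewrite cE c0 raddf0.
have f1H : (c^-1 *: f1 <= H)%MS.
  by rewrite scalemx_sub// addmx_sub// (submx_trans _ AH)// submxMl.
have AfH : (col_mx (col_mx e (c^-1 *: f1)) A <= H)%MS by rewrite !col_mx_sub eH f1H.
exists (col_mx (col_mx e (c^-1 *: f1)) A); split; first exact: AfH.
apply: symplectic_extend => //.
  by rewrite -!scalemxAl f1A scaler0.
by rewrite linearZ /= -scale_mulmxr ef1 cE scale_scalar_mx mulVf.
Qed.

End Symplectic.

(** * Curvature of a normal metric contact pair *)

Section Pointwise.
Variable R : realType.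

Lemma row_eq0P n (w : 'rV[R]_n) : (forall v : 'rV[R]_n, (w *m v^T) 0 0 = 0) -> w = 0.
Proof.
by move=> w0; apply/rowP => j; have := w0 (delta_mx 0 j); rewrite trmx_delta -colE !mxE.
Qed.

Lemma scalar_ext m n (A B : 'M[R]_(m, n)) :
  (forall (u : 'rV_m) (v : 'rV_n), (u *m A *m v^T) 0 0 = (u *m B *m v^T) 0 0) -> A = B.
Proof.
move=> AB; apply: bilinear_ext => u v.
by rewrite [LHS]mx11_scalar [RHS]mx11_scalar AB.
Qed.

Lemma posdef_unit n (G : 'M[R]_n) :
  (forall u : 'rV[R]_n, u != 0 -> 0 < (u *m G *m u^T) 0 0) -> G \in unitmx.
Proof.
move=> G_pos; rewrite -row_free_unit; apply: inj_row_free => v vG.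
by apply: contraTeq isT => /G_pos; rewrite vG mul0mx mxE ltxx.
Qed.

(** [wedge_pow_radical] provides a vector of [ker a1 /\ ker a2] orthogonal to this
    space for the 2-form; [Z1] and [Z2], which span a complement, lie in the
    radical. *)
Lemma horizontal_radical n (a1 a2 : 'cV[R]_n) (Z1 Z2 : 'rV[R]_n) (B : 'M[R]_n) k :
  Z1 *m a1 = 1%:M -> Z2 *m a2 = 1%:M -> Z2 *m a1 = 0 -> Z1 *m a2 = 0 ->
  B^T = - B -> Z1 *m B = 0 -> Z2 *m B = 0 ->
  (k.*2 + 2 <= n)%N -> (forall A, wedge_pow (kform2 (form_of B)) k A = 0) ->
  exists x : 'rV[R]_n, [/\ x != 0, x *m a1 = 0, x *m a2 = 0 & x *m B = 0].
Proof.
move=> Z1a1 Z2a2 Z2a1 Z1a2 B_skew Z1B Z2B kn b0.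
have kerP (x : 'rV[R]_n) : (x <= kermx (row_mx a1 a2))%MS -> x *m a1 = 0 /\ x *m a2 = 0.
  move/sub_kermxP; rewrite mul_mx_row -row_mx0 => /eq_row_mx; exact.
have kr : (k.*2 <= \rank (kermx (row_mx a1 a2)))%N.
  by rewrite mxrank_ker; have := rank_leq_col (row_mx a1 a2); lia.
have [x [xH x0 xB]] := wedge_pow_radical B_skew kr b0.
have [xa1 xa2] := kerP x xH.
exists x; split=> //; apply: row_eq0P => v.
have xBZ (Z : 'rV[R]_n) : Z *m B = 0 -> x *m B *m Z^T = 0.
  by move=> ZB; rewrite -[LHS]tr_mx11 !tr_mulmx trmxK B_skew mulNmx mulmxN mulmxA ZB mul0mx oppr0.
pose v' := v - v *m a1 *m Z1 - v *m a2 *m Z2.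
have v'H : (v' <= kermx (row_mx a1 a2))%MS.
  apply/sub_kermxP; rewrite mul_mx_row -row_mx0; congr row_mx; rewrite /v' !mulmxBl -!mulmxA.
    by rewrite Z1a1 Z2a1 mulmx1 !mulmx0 subr0 subrr.
  by rewrite Z1a2 Z2a2 !mulmx0 subr0 mulmx1 subrr.
have vE : v = v' + v *m a2 *m Z2 + v *m a1 *m Z1 by rewrite /v' !subrK.
clearbody v'; rewrite vE.
rewrite !tr_addmx ![(_ *m _ *m _)^T]tr_mulmx 2!mulmxDr [x *m B *m v'^T]xB//.
by rewrite !mulmxA !xBZ// !mul0mx !addr0 mxE.
Qed.

(** For [x] and [z] orthogonal and [z] of length 1, conformal flatness expresses
    [g(R(x, z) z, x)] as a sum of a term depending on [x] and of a term depending
    on [z], up to the factor [g(x, x)]. *)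
Lemma conformal_flat_pairing n (G : 'rV[R]_n -> 'M[R]_n) y (x z : 'rV[R]_n) r :
  inner G y (curv G y x z z) x = r ->
  inner G y z z = 1 -> inner G y x z = 0 -> inner G y z x = 0 ->
  conformal_curv G y x z z = 0 ->
  r + scal G y / (n.-1 * n.-2)%:R * inner G y x x
    - (n.-2)%:R^-1 * (ricci G y x x + ricci G y z z * inner G y x x) = 0.
Proof.
move=> <- zz xz zx C0; set s := scal G y / _; set c := (n.-2)%:R^-1.
have expand (L : 'rV[R]_n -> R) (K Qx Qz : 'rV[R]_n) r1 r2 :
    (forall k a b, L (k *: a + b) = k * L a + L b) -> L z = 0 ->
    L (K + s *: (1 *: x - 0 *: z) + c *: (0 *: Qz - 1 *: Qx + r1 *: z - r2 *: x)) =
    L K + s * L x - c * (L Qx + r2 * L x).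
  move=> Ll Lz; have L0 : L 0 = 0 by have := Ll (-1) 0 0; rewrite scaler0 addr0; lra.
  have LD a b : L (a + b) = L a + L b by rewrite -[a]scale1r Ll mul1r scale1r.
  have LZ k a : L (k *: a) = k * L a by rewrite -[k *: a]addr0 Ll L0 addr0.
  have LN a : L (- a) = - L a by rewrite -scaleN1r LZ mulN1r.
  by rewrite !(LD, LN, LZ) Lz; ring.
have i0 : inner G y 0 x = 0 by rewrite /inner !mul0mx mxE.
have := C0 => /(congr1 (fun w => inner G y w x)).
rewrite /conformal_curv zz xz -/s -/c (expand (fun w => inner G y w x)) //.
  by rewrite i0.
by move=> k a b; rewrite /inner !mulmxDl -!scalemxAl !mxE.
Qed.

(** The arithmetic of four sectional curvatures that are sums as in
    [conformal_flat_pairing]: they satisfy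
    [K(x1, z1) + K(x2, z2) = K(x1, z2) + K(x2, z1)], so they cannot be 1, 1, 0
    and 0. *)
Lemma mixed_curvatures_absurd (N1 N2 r1 r2 t1 t2 s d : R) :
  0 < N1 -> 0 < N2 ->
  N1 + s * N1 - d * (r1 + t1 * N1) = 0 -> 0 + s * N1 - d * (r1 + t2 * N1) = 0 ->
  0 + s * N2 - d * (r2 + t1 * N2) = 0 -> N2 + s * N2 - d * (r2 + t2 * N2) = 0 ->
  False.
Proof.
move=> N1_gt0 N2_gt0 C11 C12 C21 C22.
have /eqP : N1 * (1 - d * (t1 - t2)) = 0 by lra.
rewrite mulf_eq0 (gt_eqF N1_gt0) /= => /eqP E1.
have /eqP : N2 * (1 + d * (t1 - t2)) = 0 by lra.
rewrite mulf_eq0 (gt_eqF N2_gt0) /= => /eqP E2.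
lra.
Qed.

End Pointwise.

Section NoConformallyFlatPoint.
Variables (R : realType) (n p q : nat) (M : manifold R n).
Variables (phi : endo_field M) (Z1 Z2 : vector_field M) (a1 a2 : one_form M).
Variable g : riemannian_metric M.
Hypothesis normal : normal_metric_contact_pair p q phi Z1 Z2 a1 a2 g.
Variable c : chart_index M.
Let U := chart_img c.

Lemma chart_img_open : open U.
Proof. exact: chart_image_open. Qed.

Let a1_t := smooth_twice chart_img_open (of_smooth a1 c).
Let a2_t := smooth_twice chart_img_open (of_smooth a2 c).

Lemma Reeb_dual y : U y ->
  [/\ Z1 c y *m a1 c y = 1%:M, Z2 c y *m a2 c y = 1%:M,
      Z2 c y *m a1 c y = 0 & Z1 c y *m a2 c y = 0].
Proof.
move=> Uy; case: normal => -[[_ /(_ c y Uy)[[e1 e2] [e3 e4] _ _ _] _ _] _] _.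
by split; rewrite [LHS]mx11_scalar; move: e1 e2 e3 e4; rewrite /pairing => e1 e2 e3 e4;
  rewrite ?(e1, e2, e3, e4) ?raddf0.
Qed.

Lemma Reeb_dform y : U y ->
  [/\ Z1 c y *m dform (a1 c) y = 0, Z2 c y *m dform (a1 c) y = 0,
      Z1 c y *m dform (a2 c) y = 0 & Z2 c y *m dform (a2 c) y = 0].
Proof.
move=> Uy; case: normal => -[[_ /(_ c y Uy)[_ _ d1 d2 _] _ _] _] _.
split; apply: row_eq0P => v.
- by rewrite -(dext_atE chart_img_open _ _ a1_t Uy); case: (d1 v).
- by rewrite -(dext_atE chart_img_open _ _ a1_t Uy); case: (d2 v).
- by rewrite -(dext_atE chart_img_open _ _ a2_t Uy); case: (d1 v).
- by rewrite -(dext_atE chart_img_open _ _ a2_t Uy); case: (d2 v).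
Qed.

Lemma metric_unit y : U y -> g c y \in unitmx.
Proof. by move=> Uy; apply: posdef_unit => u u0; apply: rm_pos. Qed.

Lemma metric_phi y : U y ->
  g c y *m (phi c y)^T = dform (a1 c) y + dform (a2 c) y.
Proof.
move=> Uy; case: normal => -[_ /(_ c y Uy)[gphi _]] _.
apply: scalar_ext => u v; rewrite mulmxDr mulmxDl [RHS]mxE.
rewrite -(dext_atE chart_img_open _ _ a1_t Uy) -(dext_atE chart_img_open _ _ a2_t Uy).
by rewrite -gphi /inner tr_mulmx !mulmxA.
Qed.

Lemma metric_Reeb y : U y ->
  g c y *m (Z1 c y)^T = a1 c y /\ g c y *m (Z2 c y)^T = a2 c y.
Proof.
move=> Uy; case: normal => -[_ /(_ c y Uy)[_ gZ]] _.
by split; apply: row_ext => u; rewrite mulmxA [LHS]mx11_scalar [RHS]mx11_scalar;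
  have [] := gZ u; rewrite /inner /pairing => e1 e2; rewrite ?(e1, e2).
Qed.

Lemma Reeb_killing_chart y : U y ->
  lie_form (Z1 c) (g c) y = 0 /\ lie_form (Z2 c) (g c) y = 0.
Proof.
move=> Uy; case: (normal) => -[[_ reeb almost _] _] nrm.
have [int_J int_T] := nrm c.
apply: (@Reeb_killing _ _ _ chart_img_open (phi c) (Z1 c) (Z2 c) (a1 c) (a2 c) (g c)) => //;
  try exact: vf_smooth; try exact: of_smooth; try exact: ef_smooth; try exact: rm_smooth.
all: move=> z Uz.
all: try by have [] := Reeb_dual Uz.
all: try by have [] := Reeb_dform Uz.
all: try by have [] := reeb c z Uz.
all: try by have [] := almost c z Uz.
all: try by have [] := metric_Reeb Uz.
all: try exact: rm_sym.
exact: metric_phi.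
Qed.

Let G_s := rm_smooth g c.
Let G_sym := @rm_sym _ _ _ g c.

(** This is [|nabla_x Z|^2], where [nabla_x Z] is the vector dual to [da(x, .)]. *)
Lemma curv_Reeb (Z : vector_field M) (a : one_form M) y x :
  (forall z, U z -> lie_form (Z c) (g c) z = 0) ->
  (forall z, U z -> g c z *m (Z c z)^T = a c z) ->
  (forall z, U z -> Z c z *m dform (a c) z = 0) -> U y ->
  inner (g c) y (curv (g c) y x (Z c y) (Z c y)) x =
  - (x *m dform (a c) y *m invmx (g c y) *m dform (a c) y *m x^T) 0 0.
Proof.
move=> kill gZ Zda Uy.
have Zt := smooth_twice chart_img_open (vf_smooth Z c).
have at_ := smooth_twice chart_img_open (of_smooth a c).
have SE := nabla_mx_dform chart_img_open G_s G_sym metric_unit Zt at_ kill gZ Uy.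
rewrite /inner (curv_killing chart_img_open G_s G_sym metric_unit Zt at_ kill gZ Zda) //.
have -> : nabla_mx (g c) (Z c) y = dform (a c) y *m invmx (g c y).
  by rewrite -SE mulmxK // metric_unit.
rewrite !tr_mulmx trmx_inv (G_sym Uy) dform_tr !mulmxA mulmxKV ?metric_unit//.
by rewrite mulmxN mulNmx mxE.
Qed.

Hypotheses (nE : n = (2 * p + 2 * q + 2)%N) (p_gt0 : (0 < p)%N) (q_gt0 : (0 < q)%N).

Lemma form_of_dform (a : one_form M) y : U y ->
  dext_at (a c) y = form_of (dform (a c) y).
Proof.
move=> Uy; have at_ := smooth_twice chart_img_open (of_smooth a c).
by apply/funext => u; apply/funext => v; rewrite (dext_atE chart_img_open _ _ at_ Uy).
Qed.

(** The horizontal space has dimension [2p + 2q] with [p, q > 0], so both forms are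
    degenerate on it, as [(da1)^(p+1)] and [(da2)^(q+1)] vanish. The vectors found
    are tangent to the characteristic foliations. *)
Lemma characteristic_vectors y : U y ->
  (exists x : 'rV[R]_n, [/\ x != 0, x *m a1 c y = 0, x *m a2 c y = 0 &
     x *m dform (a2 c) y = 0]) /\
  (exists x : 'rV[R]_n, [/\ x != 0, x *m a1 c y = 0, x *m a2 c y = 0 &
     x *m dform (a1 c) y = 0]).
Proof.
move=> Uy; case: (normal) => -[[/(_ c y Uy)[_ p1 p2] _ _ _] _] _.
rewrite (form_of_dform a1 Uy) in p1; rewrite (form_of_dform a2 Uy) in p2.
have [Z1a1 Z2a2 Z2a1 Z1a2] := Reeb_dual Uy.
have [Z1d1 Z2d1 Z1d2 Z2d2] := Reeb_dform Uy.
split.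
  by apply: (horizontal_radical Z1a1 Z2a2 Z2a1 Z1a2 _ _ _ _ p2) => //;
    [exact: dform_tr|rewrite nE; lia].
by apply: (horizontal_radical Z1a1 Z2a2 Z2a1 Z1a2 _ _ _ _ p1) => //;
    [exact: dform_tr|rewrite nE; lia].
Qed.

(** The vectors of [characteristic_vectors] have sectional curvatures
    [K(x1, Z1) = K(x2, Z2) = 1] and [K(x1, Z2) = K(x2, Z1) = 0]. *)
Lemma not_conformally_flat y : U y -> ~ conformally_flat g.
Proof.
move=> Uy flat.
have [Z1a1 Z2a2 _ _] := Reeb_dual Uy.
have [gZ1 gZ2] := metric_Reeb Uy.
have [[x1 [x1n x1a1 x1a2 x1d2]] [x2 [x2n x2a1 x2a2 x2d1]]] := characteristic_vectors Uy.
have K1 x := @curv_Reeb Z1 a1 y x (fun z Uz => (Reeb_killing_chart Uz).1)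
  (fun z Uz => (metric_Reeb Uz).1) (fun z Uz => let: And4 h _ _ _ := Reeb_dform Uz in h) Uy.
have K2 x := @curv_Reeb Z2 a2 y x (fun z Uz => (Reeb_killing_chart Uz).2)
  (fun z Uz => (metric_Reeb Uz).2) (fun z Uz => let: And4 _ _ _ h := Reeb_dform Uz in h) Uy.
(* On a horizontal [x] killed by one of the two forms, the other is [g(., phi .)]. *)
have Kphi (a b : one_form M) x : g c y *m (phi c y)^T = dform (a c) y + dform (b c) y ->
    x *m a1 c y = 0 -> x *m a2 c y = 0 -> x *m dform (b c) y = 0 ->
    - (x *m dform (a c) y *m invmx (g c y) *m dform (a c) y *m x^T) 0 0 =
    inner (g c) y x x.
  move=> gphi xa1 xa2 xb; have gu := metric_unit Uy; have gT := G_sym Uy.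
  have xa : x *m dform (a c) y = x *m (g c y *m (phi c y)^T).
    by rewrite gphi mulmxDr xb addr0.
  have ax : dform (a c) y *m x^T = - (phi c y *m g c y *m x^T).
    apply: trmx_inj; rewrite tr_mulmx trmxK dform_tr mulmxN xa.
    by rewrite raddfN /= !tr_mulmx trmxK gT mulmxA.
  have phig : phi c y *m g c y = - (g c y *m (phi c y)^T).
    apply: trmx_inj; rewrite tr_mulmx gT raddfN /= [in RHS]gphi tr_addmx !dform_tr.
    by rewrite -opprD opprK.
  have phi2 : x *m phi c y *m phi c y = - x.
    case: (normal) => -[[_ _ /(_ c y Uy)[+ _ _] _] _] _ => phi2.
    rewrite -mulmxA phi2 !mulmxDr mulmxN mulmx1 !mulmxA xa1 xa2 !mul0mx !addr0.
    by [].
  rewrite -mulmxA ax xa phig mulNmx opprK !mulmxA mulmxKV //.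
  have phi2T : (phi c y)^T *m ((phi c y)^T *m x^T) = - x^T.
    by rewrite -!tr_mulmx phi2 raddfN.
  by rewrite -!mulmxA phi2T !mulmxN mxE opprK /inner mulmxA.
have unit_Z (Z : vector_field M) (a : one_form M) :
    g c y *m (Z c y)^T = a c y -> Z c y *m a c y = 1%:M -> inner (g c) y (Z c y) (Z c y) = 1.
  by move=> gZ Za; rewrite /inner -mulmxA gZ Za mxE.
have orth (Z : vector_field M) (a : one_form M) x :
    g c y *m (Z c y)^T = a c y -> x *m a c y = 0 ->
    inner (g c) y x (Z c y) = 0 /\ inner (g c) y (Z c y) x = 0.
  move=> gZ xa; have E : inner (g c) y x (Z c y) = 0 by rewrite /inner -mulmxA gZ xa mxE.
  split=> //; rewrite -[RHS]E /inner -[in LHS](tr_mx11 (_ *m _)) !tr_mulmx trmxK (G_sym Uy).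
  by rewrite mulmxA.
have C (Z : vector_field M) (a : one_form M) x k (gZ : g c y *m (Z c y)^T = a c y)
    (Za : Z c y *m a c y = 1%:M) (xa : x *m a c y = 0) K :=
  @conformal_flat_pairing _ _ _ _ x (Z c y) k K (unit_Z _ _ gZ Za)
    (orth _ _ _ gZ xa).1 (orth _ _ _ gZ xa).2 (flat c y Uy x (Z c y) (Z c y)).
have phi12 := metric_phi Uy; have phi21 := phi12; rewrite addrC in phi21.
have k12 := K2 x1; rewrite x1d2 !mul0mx mxE oppr0 in k12.
have k21 := K1 x2; rewrite x2d1 !mul0mx mxE oppr0 in k21.
have := C Z1 a1 x1 _ gZ1 Z1a1 x1a1 (etrans (K1 x1) (Kphi _ _ _ phi12 x1a1 x1a2 x1d2)).
have := C Z2 a2 x1 _ gZ2 Z2a2 x1a2 k12.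
have := C Z1 a1 x2 _ gZ1 Z1a1 x2a1 k21.
have := C Z2 a2 x2 _ gZ2 Z2a2 x2a2 (etrans (K2 x2) (Kphi _ _ _ phi21 x2a1 x2a2 x2d1)).
have N1 : 0 < inner (g c) y x1 x1 by apply: rm_pos.
have N2 : 0 < inner (g c) y x2 x2 by apply: rm_pos.
set s := scal _ _ / _; set d := _^-1; move: N1 N2.
move: (inner _ _ x1 x1) (inner _ _ x2 x2) (ricci _ _ x1 x1) (ricci _ _ x2 x2)
  (ricci _ _ (Z1 c y) _) (ricci _ _ (Z2 c y) _) => N1 N2 r1 r2 t1 t2.
clearbody s d => N1_gt0 N2_gt0 C22 C21 C12 C11.
exact: (mixed_curvatures_absurd N1_gt0 N2_gt0 C11 C12 C21 C22).
Qed.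

End NoConformallyFlatPoint.

Theorem theorem4p1 (R : realType) (p q : nat)
    (M : manifold R (2 * p + 2 * q + 2)%N)
    (phi : endo_field M) (Z1 Z2 : vector_field M) (alpha1 alpha2 : one_form M)
    (g : riemannian_metric M) :
  (0 < p)%N -> (0 < q)%N ->
  normal_metric_contact_pair p q phi Z1 Z2 alpha1 alpha2 g ->
  conformally_flat g ->
  [/\ einstein g, negative_scalar_curvature g
    & positive_sectional_curvature g].
Proof.
move=> p_gt0 q_gt0 nrm flat.
have empty c y : ~ chart_img (M := M) c y.
  by move=> Uy; exact: (not_conformally_flat nrm erefl p_gt0 q_gt0 Uy flat).
by split=> [|c y /empty|c y /empty] //; exists 0 => c y /empty.
Qed.
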